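(* Let $s\in(0,1)$ and $d>2s$. Let $\Omega\subset\mathbb{R}^d$ be a bounded domain with Lipschitz boundary satisfying the exterior ball condition, and let $D\subset\Omega$ be an open set with Lipschitz boundary such that $$\inf_{x\in\partial D} d(x,\partial\Omega)>0,$$ where $\partial D$ is the boundary of $D$ in $\mathbb{R}^d$. For $\alpha>0$ and $n\in L^2(\Omega)$ let $u_{\alpha,n}$ be the unique minimizer over $H^s_0(\overline\Omega)$ of $$u\mapsto\int_\Omega\big(u(x)-\mathbf{1}_D(x)-n(x)\big)^2\,dx+\alpha\,|u|_{H^s}^2 .$$ Let $q>\frac{d}{2s}$, and suppose that $\alpha\to0^+$ and $\|n\|_{L^2(\Omega)}\to0$ along a sequence of pairs $(\alpha,n)$ with $n\in L^2(\Omega)\cap L^q(\Omega)$ satisfying $$\frac{\|n\|_{L^q(\Omega)}}{\alpha}\to0 .$$ Then for almost every $\theta\in(0,1)$, along this sequence, $$d_H\big(\partial\{u_{\alpha,n}>\theta\},\partial D\big)\to0 .$$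
   Context: For measurable $u:\mathbb{R}^d\to\mathbb{R}$, $|u|_{H^s}^2:=\int_{\mathbb{R}^d}\int_{\mathbb{R}^d}\frac{|u(x)-u(y)|^2}{|x-y|^{d+2s}}\,dx\,dy$, always computed on the whole space. $H^s_0(\overline\Omega):=\{u:\mathbb{R}^d\to\mathbb{R}\mid u=0\text{ on }\mathbb{R}^d\setminus\Omega,\ |u|_{H^s}<+\infty\}$. Functions in $L^p(\Omega)$ are identified with their extension by zero to $\mathbb{R}^d$. $\mathbf{1}_D$ is the function equal to $1$ on $D$ and $0$ on $D^c$. Exterior ball condition: there is a radius such that every point of $\partial\Omega$ can be touched by a ball of this radius contained in $\mathbb{R}^d\setminus\Omega$. $d(x,E):=\inf_{y\in E}|x-y|$, and $d_H(E,F):=\max\big(\sup_{x\in E}d(x,F),\ \sup_{y\in F}d(y,E)\big)$ is the Hausdorff distance. Level sets $\{u_{\alpha,n}>\theta\}\subset\mathbb{R}^d$ are those of the representative of $u_{\alpha,n}$ that is continuous in $\Omega$ (the minimizers are locally Hölder continuous in $\Omega$) and zero outside $\Omega$. *)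

(* Defs.v *)
From HB Require Import structures.
From mathcomp Require Import all_boot all_order all_algebra.
From mathcomp Require Import all_classical all_reals all_analysis.

Set Implicit Arguments.
Unset Strict Implicit.
Unset Printing Implicit Defensive.

Import Order.TTheory GRing.Theory Num.Theory.
Import numFieldNormedType.Exports.

Local Open Scope classical_set_scope.
Local Open Scope ring_scope.

Definition rv_display : measure_display.
Proof. exact: default_measure_display. Qed.

Section rv_measurable.
Context (R : realType) (d : nat).

Let coors : 'I_d -> 'rV[R]_d -> measurableTypeR R := fun i v => v ord0 i.

Let rv_set0 : g_sigma_preimage coors set0.
Proof. exact: sigma_algebra0. Qed.

Let rv_setC A : g_sigma_preimage coors A -> g_sigma_preimage coors (~` A).
Proof. exact: sigma_algebraC. Qed.

Let rv_bigcup (F : _^nat) : (forall i, g_sigma_preimage coors (F i)) ->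
  g_sigma_preimage coors (\bigcup_i (F i)).
Proof. exact: sigma_algebra_bigcup. Qed.

(* The product sigma-algebra, which is the Borel sigma-algebra of R^d. *)
HB.instance Definition _ := @isMeasurable.Build rv_display
  'rV[R]_d (g_sigma_preimage coors) rv_set0 rv_setC rv_bigcup.

Lemma measurable_coord (i : 'I_d) :
  measurable_fun [set: 'rV[R]_d] (fun v => v ord0 i : measurableTypeR R).
Proof.
move=> _ Y mY; rewrite setTI; apply: sub_sigma_algebra => /=.
rewrite -bigcup_seq/=; exists i => /=; first by rewrite mem_index_enum.
by exists Y => //; rewrite setTI.
Qed.

Lemma measurable_fun_coordP d' (T : measurableType d') (f : T -> 'rV[R]_d) :
  (forall i, measurable_fun [set: T] (fun t => f t ord0 i : measurableTypeR R)) ->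
  measurable_fun [set: T] f.
Proof.
move=> mf.
have prefS : g_sigma_preimage (fun i => coors i \o f) `<=` measurable.
  apply: smallest_sub; first exact: sigma_algebra_measurable.
  rewrite -bigcup_seq/=; apply: bigcup_sub => i _.
  by move=> A [B mB <-]; exact: mf.
move=> _ A mA; apply: prefS; rewrite g_sigma_preimage_comp.
by exists A.
Qed.

End rv_measurable.

Section lebesgue_rv.
Context (R : realType).

Definition cons_rv (d : nat) (p : measurableTypeR R * 'rV[R]_d) : 'rV[R]_d.+1 :=
  row_mx (const_mx p.1 : 'rV[R]_1) p.2.

Definition uncons_rv (d : nat) (v : 'rV[R]_d.+1) : measurableTypeR R * 'rV[R]_d :=
  (v ord0 ord0, rsubmx (v : 'rV[R]_(1 + d))).

Lemma cons_rvK (d : nat) : cancel (@cons_rv d) (@uncons_rv d).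
Proof.
move=> [x v]; rewrite /cons_rv /uncons_rv /= row_mxKr; congr pair.
have -> : ord0 = lshift d (ord0 : 'I_1) by exact: val_inj.
by rewrite [LHS](row_mxEl (const_mx x) v) mxE.
Qed.

Lemma measurable_cons_rv (d : nat) : measurable_fun setT (@cons_rv d).
Proof.
apply: measurable_fun_coordP => i.
have [j|j] := split_ordP (i : 'I_(1 + d)) => ->.
  apply: (eq_measurable_fun fst) => //.
  by move=> p _; rewrite [RHS](row_mxEl (const_mx p.1) p.2) mxE.
apply: (eq_measurable_fun ((fun v : 'rV[R]_d => v ord0 j) \o snd)).
  by move=> p _; rewrite [RHS](row_mxEr (const_mx p.1) p.2).
exact: (measurableT_comp (measurable_coord j)).
Qed.

Lemma measurable_uncons_rv (d : nat) : measurable_fun setT (@uncons_rv d).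
Proof.
apply: measurable_fun_pair; first exact: measurable_coord.
apply: measurable_fun_coordP => i.
apply: (eq_measurable_fun (fun v : 'rV[R]_d.+1 => v ord0 (rshift 1 i))).
  by move=> v _; rewrite mxE.
exact: measurable_coord.
Qed.

Section step.
Context (d : nat) (m : {sigma_finite_measure set 'rV[R]_d -> \bar R}).

Definition lebesgue_step : set 'rV[R]_d.+1 -> \bar R :=
  pushforward ((@lebesgue_measure R) \x m)%E (@cons_rv d).

Let step0 : lebesgue_step set0 = 0%E.
Proof. by rewrite /lebesgue_step /pushforward preimage_set0 measure0. Qed.

Let step_ge0 A : (0 <= lebesgue_step A)%E.
Proof. by rewrite /lebesgue_step /pushforward; exact: measure_ge0. Qed.

Let step_sigma_additive : semi_sigma_additive lebesgue_step.
Proof.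
move=> F mF tF mUF; rewrite /lebesgue_step /pushforward preimage_bigcup.
have mpre A : measurable A -> measurable (@cons_rv d @^-1` A).
  by move=> mA; rewrite -[X in measurable X]setTI; exact: measurable_cons_rv.
apply: measure_semi_sigma_additive.
- by move=> n; exact: mpre.
- apply/trivIsetP => /= i j _ _ ij; rewrite -preimage_setI.
  by move/trivIsetP : tF => /(_ _ _ _ _ ij) ->//; rewrite preimage_set0.
- by rewrite -preimage_bigcup; exact: mpre.
Qed.

HB.instance Definition _ := isMeasure.Build _ _ _ lebesgue_step
  step0 step_ge0 step_sigma_additive.

Let step_sigma_finite : sigma_finite setT lebesgue_step.
Proof.
have /sigma_finiteP[F [TF ndF Foo]] := sigma_finiteT (@lebesgue_measure R).
have /sigma_finiteP[G [TG ndG Goo]] := sigma_finiteT m.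
exists (fun k => @uncons_rv d @^-1` (F k `*` G k)).
  rewrite -preimage_bigcup (_ : \bigcup_k _ = setT) ?preimage_setT//.
  rewrite -setXTT TF TG predeqE => -[x y]; split.
    by move=> [n _ []/= ? ?]; split; exists n.
  move=> [/= [n _ Fnx] [k _ Gky]]; exists (maxn n k) => //; split.
  - by move: x Fnx; exact/subsetPset/ndF/leq_maxl.
  - by move: y Gky; exact/subsetPset/ndG/leq_maxr.
move=> k; have [mF Fk] := Foo k; have [mG Gk] := Goo k.
have mFG : measurable (F k `*` G k) by exact: measurableX.
split; first by rewrite -[X in measurable X]setTI; exact: measurable_uncons_rv.
rewrite /lebesgue_step /pushforward -comp_preimage.
rewrite (_ : _ \o _ = id) ?preimage_id; last first.
  by apply/funext => p /=; exact: cons_rvK.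
by rewrite product_measure1E// lte_mul_pinfty// ge0_fin_numE.
Qed.

HB.instance Definition _ := Measure_isSigmaFinite.Build _ _ _ lebesgue_step
  step_sigma_finite.

End step.

(* Lebesgue measure on the Borel sets of R^d, as the d-fold product of the
   one-dimensional Lebesgue measure (a point mass when d = 0). *)
Fixpoint borel_lebesgue (d : nat) : {sigma_finite_measure set 'rV[R]_d -> \bar R} :=
  match d with
  | 0 => \d_(0 : 'rV[R]_0)
  | d'.+1 => lebesgue_step (borel_lebesgue d')
  end.

End lebesgue_rv.

(* R^d with the Lebesgue sigma-algebra: the Caratheodory-measurable sets of the
   outer measure induced by [borel_lebesgue]. *)
Definition lebesgueR (R : realType) (d : nat) : measurableType _ :=
  caratheodory_type (mu_ext (borel_lebesgue R d)).

Definition lebesgue (R : realType) (d : nat) :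
    {measure set (lebesgueR R d) -> \bar R} :=
  @completed_measure_extension _ 'rV[R]_d R (borel_lebesgue R d).

Section euclidean.
Context (R : realType) (d : nat).
Implicit Types (x y : 'rV[R]_d) (A E F : set 'rV[R]_d).

Definition dotv x y : R := \sum_i x ord0 i * y ord0 i.

(* The library norm of ['rV[R]_d] is the sup norm; it induces the same topology
   and the same bounded sets. *)
Definition enorm x : R := Num.sqrt (dotv x x).

Definition bdry A : set 'rV[R]_d := closure A `\` interior A.

(* d(x, E), with value +oo when E is empty. *)
Definition dist_set x E : \bar R := ereal_inf [set (enorm (x - y))%:E | y in E].

(* Suprema are taken in [0, +oo], so that the empty supremum is 0 (in [\bar R],
   [ereal_sup set0] is -oo). *)
Definition hausdorff_dist E F : \bar R :=
  maxe 0%E (maxe (ereal_sup [set dist_set x F | x in E])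
                 (ereal_sup [set dist_set y E | y in F])).

(* Near each boundary point, A is the strict epigraph of a Lipschitz function
   over the hyperplane orthogonal to a unit vector e. The orthogonal projection
   on the hyperplane is y - <y, e> e; g is used only there, and asking for it to
   be Lipschitz on R^d is no restriction. For d = 1 the hyperplane is a point. *)
Definition lipschitz_boundary A : Prop :=
  forall x, bdry A x ->
  exists (r : R) (e : 'rV[R]_d) (g : 'rV[R]_d -> R) (L : R),
    [/\ 0 < r, enorm e = 1,
        forall y z, `|g y - g z| <= L * enorm (y - z)
      & forall y, enorm (y - x) < r ->
          (A y <-> g (y - dotv y e *: e) < dotv y e)].

(* Stated with open balls: for open A, an open ball lies in the complement of A
   iff its closure does. *)
Definition exterior_ball A : Prop :=
  exists2 rho : R, 0 < rho &
  forall x, bdry A x ->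
  exists c, enorm (x - c) = rho /\ (forall y, enorm (y - c) < rho -> ~ A y).

Definition bounded_domain A : Prop :=
  [/\ open A, connected A, A !=set0 & bounded_set A].

End euclidean.

Section function_spaces.
Context (R : realType) (d : nat).
Local Notation mu := (lebesgue R d).
Implicit Types (u v n : 'rV[R]_d -> R) (Omega D : set 'rV[R]_d).

Definition zero_ext Omega u : 'rV[R]_d -> R := patch (cst 0) Omega u.

Definition in_Lp Omega (p : R) u : Prop :=
  (zero_ext Omega u : lebesgueR R d -> R) \in Lfun mu p%:E.

(* [fine] is harmless: the norm is finite for the functions in L^p(Omega). *)
Definition Lp_norm Omega (p : R) u : R :=
  fine ('N[mu]_(p%:E)[EFin \o zero_ext Omega u])%E.

(* On the null set x = y the integrand is 0, since 0^-1 = 0. *)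
Definition Hs_seminorm2 (s : R) u : \bar R :=
  (\int[mu]_x \int[mu]_y
     (`|u x - u y| ^+ 2 / enorm (x - y) `^ (d%:R + 2 * s))%:E)%E.

Definition Hs0 (s : R) Omega u : Prop :=
  [/\ measurable_fun [set: lebesgueR R d] u,
      forall x, ~ Omega x -> u x = 0
    & (Hs_seminorm2 s u < +oo)%E].

Definition energy (s : R) Omega D (alpha : R) n u : \bar R :=
  (\int[mu]_(x in Omega) ((u x - \1_D x - n x) ^+ 2)%:E
   + alpha%:E * Hs_seminorm2 s u)%E.

Definition minimizer (s : R) Omega D (alpha : R) n u : Prop :=
  Hs0 s Omega u /\
  (forall v, Hs0 s Omega v ->
     (energy s Omega D alpha n u <= energy s Omega D alpha n v)%E).

End function_spaces.

(* Main.v *)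
(* Away from the boundary of D the minimizers converge uniformly to 1_D, so that for
   every theta in (0, 1) the level set boundaries are trapped near that of D.

   For the upper bound at x0, at distance r from D, take psi(x) = min(1, |x-x0|^2/r^2),
   which dominates 1_D and has second differences at most min(2|h|^2/r^2, 2). Let
   T = min((u - psi - k)_+, l). Comparing u with u - T, the semiconcavity of psi
   costs alpha C int T, with C = 2 int min(2|h|^2/r^2, 2) |h|^(-d-2s) dh, while the
   fidelity term gains 2 k int T. Once 2 k >= alpha C this leaves
   alpha |T|_{H^s}^2 <= 2 l int_{u - psi > k} |n|. A ball of volume twice that of
   A_k = {u - psi > k} is at most half filled by A_k, so that
   |T|_{H^s}^2 >= c l^2 |A_{k+l}| |A_k|^(-2s/d), and with Hoelder's inequality
   |A_{k+l}| <= C' (|n|_q / (alpha l)) |A_k|^(1 - 1/q + 2s/d). The exponent exceeds 1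
   because q > d/(2s), hence A_{2e} is null as soon as alpha and |n|_q / alpha are
   small with respect to e, and u(x0) <= 2 e by continuity. The lower bound inside D
   is the same statement for -u, -1_D, -n and the barrier psi - 1. *)

Require Import Defs.
From mathcomp Require Import all_boot all_order all_algebra.
From mathcomp Require Import all_classical all_reals all_analysis.
From mathcomp Require Import measurable_realfun.
From mathcomp Require Import ring lra.

Set Implicit Arguments.
Unset Strict Implicit.
Unset Printing Implicit Defensive.

Import Order.TTheory GRing.Theory Num.Theory.
Import numFieldNormedType.Exports.

Local Open Scope classical_set_scope.
Local Open Scope ring_scope.

(** * Geometry of R^d *)

(** Tonelli's theorem and translation invariance are used on [borel_lebesgue], a product measure,
    while the statement is about its completion [lebesgue]. The continuous representative of a
    minimizer is Borel, and so are the barrier and the truncation; the seminorm is therefore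
    computed with the Borel measure. The noise is only Lebesgue measurable, so the fidelity
    integrals stay with [lebesgue] on [Omega]. The barrier must work on the whole space because the
    seminorm is nonlocal. Cutting the paraboloid off at 1 makes its second differences integrable
    against the kernel at the origin (order |h|^2, s < 1) and at infinity (bounded, s > 0). Balls
    are those of the sup norm, that is cubes of volume (2 r)^d; comparison with the Euclidean kernel
    costs powers of sqrt d. The passage to boundaries rests on one fact: a segment from a point of a
    set to a point of its complement meets the boundary of the set. Applied to [D] and to the level
    set, it gives the two halves of the Hausdorff distance. *)

Section euclidean_space.
Context (R : realType) (d : nat).
Implicit Types x y z : 'rV[R]_d.

Lemma norm_coord_le x i : `|x ord0 i| <= `|x|.
Proof.
rewrite [leRHS]/Num.norm/= mx_normrE.
by apply/bigmax_geP; right => /=; exists (ord0, i).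
Qed.

Lemma normv_le x (a : R) : 0 <= a -> (forall i, `|x ord0 i| <= a) -> `|x| <= a.
Proof.
move=> a0 xa; rewrite [leLHS]/Num.norm/= mx_normrE.
by apply/bigmax_leP; split => // -[i j] _ /=; rewrite ord1.
Qed.

Lemma normv_ltP x (a : R) : 0 < a -> `|x| < a <-> (forall i, `|x ord0 i| < a).
Proof.
move=> a0; split => [xa i|xa]; first exact: le_lt_trans (norm_coord_le _ _) xa.
rewrite [ltLHS]/Num.norm/= mx_normrE.
by apply/bigmax_ltP; split => // -[i j] _ /=; rewrite ord1.
Qed.

Lemma dotvC x y : dotv x y = dotv y x.
Proof. by apply: eq_bigr => i _; rewrite mulrC. Qed.

Lemma dotvDl x y z : dotv (x + y) z = dotv x z + dotv y z.
Proof. by rewrite -big_split/=; apply: eq_bigr => i _; rewrite mxE mulrDl. Qed.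

Lemma dotvZl (a : R) x y : dotv (a *: x) y = a * dotv x y.
Proof. by rewrite /dotv mulr_sumr; apply: eq_bigr => i _; rewrite mxE mulrA. Qed.

Lemma dotvNl x y : dotv (- x) y = - dotv x y.
Proof. by rewrite -scaleN1r dotvZl mulN1r. Qed.

Lemma dotvDr x y z : dotv x (y + z) = dotv x y + dotv x z.
Proof. by rewrite dotvC dotvDl !(dotvC x). Qed.

Lemma dotvNr x y : dotv x (- y) = - dotv x y.
Proof. by rewrite dotvC dotvNl (dotvC x). Qed.

Lemma dotv_ge0 x : 0 <= dotv x x.
Proof. by apply: sumr_ge0 => i _; rewrite -expr2 sqr_ge0. Qed.

Lemma enorm_ge0 x : 0 <= enorm x.
Proof. exact: sqrtr_ge0. Qed.

Lemma sqr_enorm x : enorm x ^+ 2 = dotv x x.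
Proof. by rewrite sqr_sqrtr// dotv_ge0. Qed.

Lemma enormN x : enorm (- x) = enorm x.
Proof. by rewrite /enorm dotvNl dotvNr opprK. Qed.

Lemma norm_le_enorm x : `|x| <= enorm x.
Proof.
apply: normv_le; first exact: enorm_ge0.
move=> i; rewrite -sqrtr_sqr ler_wsqrtr// expr2 /dotv (bigD1 i)//= lerDl.
by apply: sumr_ge0 => j _; rewrite -expr2 sqr_ge0.
Qed.

Lemma enorm_le_norm x : enorm x <= Num.sqrt d%:R * `|x|.
Proof.
rewrite -[`|x|]ger0_norm// -sqrtr_sqr -sqrtrM ?ler0n// ler_wsqrtr//.
rewrite mulr_natl -[X in _ *+ X]card_ord -sumr_const; apply: ler_sum => i _.
by rewrite -expr2 -real_normK ?num_real// lerXn2r// ?nnegrE// norm_coord_le.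
Qed.

End euclidean_space.

Section segments.
Context (R : realType) (d : nat).
Implicit Types (x y a b : 'rV[R]_d) (A : set 'rV[R]_d).

Lemma bdryP A x : bdry A x <->
  (forall r, 0 < r -> exists y z, [/\ A y, ~ A z, `|x - y| < r & `|x - z| < r]).
Proof.
split.
  move=> [cx nix] r r0.
  have [y [Ay]] : A `&` ball x r !=set0 by apply: cx; exact: nbhsx_ballx.
  rewrite -ball_normE /= => xy.
  suff [z nAz xz] : exists2 z, ~ A z & `|x - z| < r by exists y, z.
  apply: contrapT => H; apply: nix; apply/nbhs_ballP; exists r => //= z.
  rewrite -ball_normE /= => xz; apply: contrapT => nAz; apply: H; by exists z.
move=> H; split.
  move=> B /nbhs_ballP[r/= r0 rB]; have [y [_ [Ay _ xy _]]] := H _ r0.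
  by exists y; split => //; apply: rB; rewrite -ball_normE.
move=> /nbhs_ballP[r/= r0 rA]; have [_ [z [_ nAz _ xz]]] := H _ r0.
by apply: nAz; apply: rA; rewrite -ball_normE.
Qed.

(* The boundary point is the last exit time from A along the segment. *)
Lemma segment_meets_bdry A x (r : R) a b : `|x - a| < r -> `|x - b| < r ->
  A a -> ~ A b -> exists2 y, bdry A y & `|x - y| < r.
Proof.
move=> xa xb Aa nAb.
pose c t : 'rV[R]_d := a + t *: (b - a).
have c0 : c 0 = a by rewrite /c scale0r addr0.
have c1 : c 1 = b by rewrite /c scale1r addrC subrK.
have cd t u : `|c t - c u| <= `|t - u| * `|b - a|.
  rewrite /c opprD addrACA subrr add0r -scalerBl normrZ//.
pose S := [set t | 0 <= t <= 1 /\ A (c t)].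
have S0 : S 0 by rewrite /S/= lexx ler01 c0.
have supS : has_sup S.
  by split; [exists 0|exists 1 => t [/andP[]]].
have s0 : 0 <= sup S by exact: ub_le_sup supS.2 _ S0.
have s1 : sup S <= 1 by apply: ge_sup; [exists 0|move=> t [/andP[]]].
exists (c (sup S)).
  apply/bdryP => e e0.
  have [D [D0 hD]] : exists D, 0 < D /\ forall t, `|sup S - t| < D -> `|c (sup S) - c t| < e.
    exists (e / (`|b - a| + 1)); have p : 0 < `|b - a| + 1 by rewrite ltr_wpDl.
    split=> [|t]; first exact: divr_gt0.
    rewrite ltr_pdivlMr// => h; apply: le_lt_trans (cd _ _) (le_lt_trans _ h).
    by rewrite ler_wpM2l// lerDl.
  have [t [t01 At] st] := sup_adherent D0 supS.
  have tS : t <= sup S by apply: (ub_le_sup supS.2); split.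
  (* Points of [A] lie at or just before the supremum; a point outside [A] is taken just after it,
     or is [b] itself when the supremum is 1. *)
  suff [u nAu su] : exists2 u, ~ A (c u) & `|sup S - u| < D.
    exists (c t), (c u); split => //; apply: hD => //.
    by rewrite ger0_norm ?subr_ge0// ltrBlDr -ltrBlDl.
  have [sE|sN1] := eqVneq (sup S) 1.
    by exists 1; rewrite ?c1// sE subrr normr0.
  have s1' : sup S < 1 by rewrite lt_neqAle sN1.
  pose u := sup S + Num.min (D / 2) (1 - sup S).
  have m0 : 0 < Num.min (D / 2) (1 - sup S) by rewrite lt_min divr_gt0//= subr_gt0.
  exists u.
    move=> Au; suff : u <= sup S by rewrite /u gerDl leNgt m0.
    apply: (ub_le_sup supS.2); split => //.
    have : Num.min (D / 2) (1 - sup S) <= 1 - sup S by rewrite ge_min lexx orbT.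
    by rewrite lerBrDl => ->; rewrite andbT addr_ge0// ltW.
  rewrite opprD addrA subrr add0r normrN gtr0_norm//.
  by rewrite gt_min ltr_pdivrMr// ltr_pMr// ltr1n.
have -> : x - c (sup S) = (1 - sup S) *: (x - a) + sup S *: (x - b).
  by apply/rowP => i; rewrite !mxE; ring.
apply: le_lt_trans (ler_normD _ _) _; rewrite !normrZ (ger0_norm s0).
rewrite ger0_norm ?subr_ge0//.
(* The strict inequality comes from the endpoint [a] when the weight of [b] vanishes, and from [b]
   otherwise. *)
have [sE|sN0] := eqVneq (sup S) 0.
  by rewrite sE subr0 mul1r mul0r addr0.
have s0' : 0 < sup S by rewrite lt_neqAle eq_sym sN0.
have := ler_wpM2l (_ : 0 <= 1 - sup S) (ltW xa); rewrite subr_ge0 => /(_ s1).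
have := xb; rewrite -(ltr_pM2l s0'); lra.
Qed.

End segments.

(** * Lebesgue measure on R^d *)

Section borel_sets.
Context (R : realType) (d : nat).
Implicit Types (x : 'rV[R]_d) (A : set 'rV[R]_d).

Lemma ballvE x (r : R) : ball x r = [set y | `|x - y| < r].
Proof. by rewrite -ball_normE. Qed.

Lemma measurable_ballv x (r : R) : measurable (ball x r).
Proof.
have [r0|r0] := ltP 0 r; last first.
  have -> : ball x r = set0.
    apply/seteqP; split => // y; rewrite ballvE/= => /(le_lt_trans (normr_ge0 _)).
    by rewrite ltNge r0.
  exact: measurable0.
have -> : ball x r =
    \bigcap_(i in [set: 'I_d]) [set y : 'rV[R]_d | `|x ord0 i - y ord0 i| < r].
  rewrite ballvE; apply/seteqP; split => y /=.
    by move=> /(normv_ltP _ r0) H i _; have := H i; rewrite !mxE.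
  by move=> H; apply/(normv_ltP _ r0) => i; have := H i Logic.I; rewrite !mxE.
apply: fin_bigcap_measurable => // i _.
have mf : measurable_fun [set: 'rV[R]_d]
    (fun y => `|x ord0 i - y ord0 i| : measurableTypeR R).
  apply: measurableT_comp => //; apply: measurable_funB => //.
  exact: measurable_coord.
rewrite -[X in measurable X]setTI.
have := mf measurableT `]-oo, r[%classic (measurable_itv _).
by congr measurable; apply/seteqP; split => y /= [_]; rewrite in_itv/=.
Qed.

(** The sigma-algebra is generated by the coordinates. An open set belongs to it as the union of the
    countably many cubes with rational centre and radius 1/(m+1) that it contains. *)
Lemma open_measurable_rv A : open A -> measurable A.
Proof.
move=> oA.
pose f (q : 'rV[rat]_d) : 'rV[R]_d := \row_i ratr (q ord0 i).
pose B (p : 'rV[rat]_d * nat) : set 'rV[R]_d :=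
  if `[< ball (f p.1) p.2.+1%:R^-1 `<=` A >]
  then ball (f p.1) p.2.+1%:R^-1 else set0.
have -> : A = \bigcup_p B p.
  apply/seteqP; split => [x Ax|x [p _]]; last first.
    by rewrite /B; case: asboolP => // + xp; exact.
  have /nbhs_ballP[e /= e0 xe] : nbhs x A by exact: open_nbhs_nbhs.
  have [n ne] : exists n, n.+1%:R^-1 < e / 2.
    have := @near_infty_natSinv_lt R (PosNum (divr_gt0 e0 (@ltr0n R 2))).
    by move=> [N _ /(_ N (leqnn N))]; exists N.
  have [q qx] : exists q : 'rV[rat]_d, `|x - f q| < n.+1%:R^-1 :> R.
    have /choice[q hq] : forall i, exists q : rat, `|x ord0 i - ratr q| < n.+1%:R^-1.
      move=> i; have [|q] := @rat_in_itvoo R (x ord0 i - n.+1%:R^-1) (x ord0 i + n.+1%:R^-1).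
        by rewrite ltrD2l gtrN.
      rewrite in_itv/= => /andP[q1 q2]; exists q.
      move: q1 q2; set y := ratr q; set e1 := _^-1 => q1 q2.
      by rewrite ltr_norml; apply/andP; split; lra.
    exists (\row_i q i); apply/normv_ltP => // i.
    by rewrite !mxE; exact: hq.
  exists (q, n) => //; rewrite /B/=; case: asboolP => [_|]; last first.
    case=> y; rewrite ballvE/= => qy; apply: xe; rewrite ballvE/=.
    have -> : x - y = (x - f q) + (f q - y) by rewrite addrA subrK.
    apply: le_lt_trans (ler_normD _ _) _.
    by move: ne qx qy; set e1 := _^-1 => ne qx qy; lra.
  by rewrite ballvE/= distrC.
apply: countable_bigcupT_measurable; first exact: countableP.
move=> p; rewrite /B; case: asboolP => // _; exact: measurable_ballv.
Qed.

(** Membership in [Hs0] gives Lebesgue measurability only; this upgrades a minimizer to a Borel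
    function, as iterated integration over [borel_lebesgue] requires. *)
Lemma measurable_continuous_ext A (u : 'rV[R]_d -> R) : open A ->
  (forall x, A x -> {for x, continuous u}) -> (forall x, ~ A x -> u x = 0) ->
  measurable_fun setT u.
Proof.
move=> oA cu u0.
have mA := open_measurable_rv oA.
have -> : u = u \_ A.
  apply/funext => x; rewrite patchE; case: ifPn => // /negP.
  by rewrite inE => /u0.
apply/(measurable_restrictT u mA).
apply: (measurability _ (RGenOpens.measurableE R)) => _ [_ [a [b ->] <-]].
apply: open_measurable_rv; rewrite openE => x [Ax].
move=> /= xab; rewrite /interior.
apply: filterI; first by apply: open_nbhs_nbhs; split.
apply: cu => //; apply: open_nbhs_nbhs; split; last by []. exact: interval_open.
Qed.

Lemma measurable_enorm : measurable_fun setT (@enorm R d).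
Proof.
have mdot : measurable_fun setT (fun x : 'rV[R]_d => dotv x x).
  by apply: measurable_sum => i; apply: measurable_funM; exact: measurable_coord.
apply: (measurableT_comp (f := @Num.sqrt R)) mdot.
by apply: continuous_measurable_fun; exact: sqrt_continuous.
Qed.

Lemma measurable_addv d' (T : measurableType d') (f g : T -> 'rV[R]_d) :
  measurable_fun setT f -> measurable_fun setT g ->
  measurable_fun setT (fun t => f t + g t).
Proof.
move=> mf mg; apply: measurable_fun_coordP => i.
apply: (eq_measurable_fun (fun t => f t ord0 i + g t ord0 i)).
  by move=> t _; rewrite mxE.
by apply: measurable_funD; apply: (measurableT_comp (measurable_coord i)).
Qed.

Lemma measurable_oppv d' (T : measurableType d') (f : T -> 'rV[R]_d) :
  measurable_fun setT f -> measurable_fun setT (fun t => - f t).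
Proof.
move=> mf; apply: measurable_fun_coordP => i.
apply: (eq_measurable_fun (fun t => - f t ord0 i)).
  by move=> t _; rewrite mxE.
by apply: measurable_funN; apply: (measurableT_comp (measurable_coord i)).
Qed.

End borel_sets.

(** * Translation invariance, volumes of cubes, and transfer to the completed measure *)

Section lebesgue_line.
Context (R : realType).
Local Notation leb := (@lebesgue_measure R).

Lemma measurable_addr (h : R) :
  measurable_fun [set: measurableTypeR R] (fun x => x + h : measurableTypeR R).
Proof. by apply: measurable_funD. Qed.

(** The image of Lebesgue measure under a translation gives every half-open interval its length, and
    this property characterizes Lebesgue measure. *)
Lemma ge0_integral_shiftR (h : R) (f : measurableTypeR R -> \bar R) :
  measurable_fun setT f -> (forall x, 0 <= f x)%E ->
  (\int[leb]_x f (x + h)%R = \int[leb]_x f x)%E.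
Proof.
move=> mf f0.
transitivity (\int[pushforward leb (fun x => x + h : measurableTypeR R)%R]_x f x)%E.
  by rewrite ge0_integral_pushforward//; exact: measurable_addr.
have mh := measurable_addr h.
pose m : {measure set (measurableTypeR R) -> \bar R} :=
  measure_function_pushforward__canonical__measure_function_Measure leb mh.
apply: (@eq_measure_integral _ _ _ _ leb m) => A mA _.
symmetry; apply: (@lebesgue_measure_unique R m) => // _ [[a b] _ <-].
rewrite /m/=.
rewrite /pushforward (_ : _ @^-1` _ = `](a - h), (b - h)]%classic); last first.
  by apply/seteqP; split => x /=; rewrite !in_itv/= ltrBlDr lerBrDr.
rewrite !lebesgue_measure_itv/= !lte_fin ltrD2r; case: ifP => // _.
by rewrite -!EFinB; congr EFin; ring.
Qed.

End lebesgue_line.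

Section lebesgue_space.
Context (R : realType).
Local Notation leb := (@lebesgue_measure R).
Local Notation lam d := (borel_lebesgue R d).
Local Open Scope ereal_scope.

Lemma ge0_integral_borel_lebesgueS d (f : 'rV[R]_d.+1 -> \bar R) :
  measurable_fun setT f -> (forall x, 0 <= f x) ->
  \int[lam d.+1]_x f x = \int[leb]_a \int[lam d]_v f (cons_rv (a, v)).
Proof.
move=> mf f0.
transitivity (\int[pushforward (leb \x lam d) (@cons_rv R d)]_x f x); first by [].
rewrite ge0_integral_pushforward//; last exact: measurable_cons_rv.
rewrite preimage_setT fubini_tonelli1//=; last first.
  by apply: measurableT_comp => //; exact: measurable_cons_rv.
Qed.

Lemma cons_rv_l d (a : R) (v : 'rV[R]_d) (j : 'I_1) :
  cons_rv (a, v) ord0 (lshift d j : 'I_d.+1) = a.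
Proof. by rewrite [LHS](row_mxEl (const_mx a) v) mxE. Qed.

Lemma cons_rv_r d (a : R) (v : 'rV[R]_d) (j : 'I_d) :
  cons_rv (a, v) ord0 (rshift 1 j : 'I_d.+1) = v ord0 j.
Proof. by rewrite [LHS](row_mxEr (const_mx a) v). Qed.

Lemma cons_rvD d (a : R) (v : 'rV[R]_d) (h : 'rV[R]_d.+1) :
  (cons_rv (a, v) + h = cons_rv (a + h ord0 ord0, v + rsubmx (h : 'rV[R]_(1 + d))))%R.
Proof.
apply/rowP => i; rewrite mxE; have [j|j] := split_ordP (i : 'I_(1 + d)) => ->.
  rewrite !cons_rv_l; congr (_ + h _ _)%R.
  by apply: val_inj; rewrite /= ord1.
by rewrite !cons_rv_r !mxE.
Qed.

Lemma measurable_cons_rv_r d (a : R) :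
  measurable_fun setT (fun v : 'rV[R]_d => cons_rv (a, v)).
Proof.
apply: (measurableT_comp (f := @cons_rv R d)); first exact: measurable_cons_rv.
exact: measurable_pair1.
Qed.

(** By induction on the dimension: the first coordinate is shifted by invariance on the line, the
    remaining ones by the induction hypothesis. *)
Lemma ge0_integral_shift d (h : 'rV[R]_d) (f : 'rV[R]_d -> \bar R) :
  measurable_fun setT f -> (forall x, 0 <= f x) ->
  \int[lam d]_x f (x + h)%R = \int[lam d]_x f x.
Proof.
elim: d h f => [|d IH] h f mf f0.
  by apply: eq_integral => x _; congr f; apply/rowP; case.
have mfh : measurable_fun setT (fun x : 'rV[R]_d.+1 => f (x + h)%R).
  by apply: measurableT_comp => //; apply: measurable_addv.
rewrite (ge0_integral_borel_lebesgueS mf f0).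
rewrite (ge0_integral_borel_lebesgueS mfh (fun x => f0 _)).
under eq_integral do under eq_integral do rewrite cons_rvD.
transitivity (\int[leb]_a \int[lam d]_v f (cons_rv (a + h ord0 ord0, v)%R)).
  apply: eq_integral => a _.
  rewrite (IH (rsubmx (h : 'rV[R]_(1 + d)))
    (fun v => f (cons_rv (a + h ord0 ord0, v)%R)))//.
  by apply: measurableT_comp => //; exact: measurable_cons_rv_r.
apply: (@ge0_integral_shiftR R _ (fun a => \int[lam d]_v f (cons_rv (a, v)))).
  apply: (measurable_fun_fubini_tonelli_F (f \o @cons_rv R d)) => //.
  by apply: measurableT_comp => //; exact: measurable_cons_rv.
  by move=> p; exact: f0.
by move=> a; apply: integral_ge0 => v _; exact: f0.
Qed.

Lemma borel_lebesgue_ball0 d (r : R) : (0 < r)%R ->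
  lam d (ball (0 : 'rV[R]_d)%R r) = ((2 * r) ^+ d)%:E.
Proof.
move=> r0; elim: d => [|d IH].
  rewrite /= diracE mem_set//; exact: ballxx.
rewrite /= /lebesgue_step /pushforward.
rewrite (_ : _ @^-1` _ = `](- r)%R, r[%classic `*` ball (0 : 'rV[R]_d)%R r); last first.
  apply/seteqP; split => -[a v]; rewrite /= !ballvE/= !sub0r !normrN.
    move=> /(normv_ltP _ r0) H; split => /=.
      rewrite in_itv/= -ltr_norml; have := H (lshift d (ord0 : 'I_1) : 'I_(1 + d)).
      by rewrite cons_rv_l.
    apply/(normv_ltP _ r0) => i; have := H (rshift 1 i).
    by rewrite cons_rv_r.
  move=> [/=]; rewrite in_itv/= -ltr_norml => ar /(normv_ltP _ r0) vr.
  apply/(normv_ltP _ r0) => i.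
  have [j|j] := split_ordP (i : 'I_(1 + d)) => ->.
    by rewrite cons_rv_l.
  by rewrite cons_rv_r.
rewrite product_measure1E//; last exact: measurable_ballv.
have l2r : leb `](- r)%R, r[%classic = (2 * r)%:E.
  by rewrite lebesgue_measure_itv/= lte_fin gtrN// -EFinB; congr EFin; ring.
by rewrite exprS EFinM; congr (_ * _).
Qed.

Lemma borel_lebesgue_ball d (c : 'rV[R]_d) (r : R) : (0 < r)%R ->
  lam d (ball c r) = ((2 * r) ^+ d)%:E.
Proof.
move=> r0; apply: etrans (borel_lebesgue_ball0 d r0).
have E x : lam d (ball x r) = \int[lam d]_y (\1_(ball x r) y)%:E.
  have mb := measurable_ballv x r.
  by rewrite (integral_indic (lam d) measurableT mb) setIT.
have m1 : measurable_fun setT (fun y : 'rV[R]_d => (\1_(ball c r) y : R)%:E).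
  by apply/measurable_EFinP; apply: measurable_indic; exact: measurable_ballv.
rewrite (E c) (E 0%R).
rewrite -(@ge0_integral_shift d c _ m1); last by move=> x; rewrite lee_fin.
apply: eq_integral => x _; congr EFin; rewrite !indicE /in_mem/= /in_set.
have -> : (ball c r (x + c)%R : Prop) = ball (0 : 'rV[R]_d)%R r x.
  by rewrite !ballvE/= opprD addrCA subrr addr0 sub0r.
by [].
Qed.

Variable d : nat.
Local Notation mu := (lebesgue R d).

Lemma borel_lebesgueE (A : set 'rV[R]_d) : measurable A -> mu A = lam d A.
Proof. exact: measurable_mu_extE. Qed.

Lemma lebesgue_measurable (A : set 'rV[R]_d) : measurable A ->
  measurable (A : set (lebesgueR R d)).
Proof. exact: caratheodory_measurable_mu_ext. Qed.

Lemma lebesgue_measurable_id :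
  measurable_fun [set: lebesgueR R d] (id : lebesgueR R d -> 'rV[R]_d).
Proof. by move=> _ A mA; rewrite setTI; exact: lebesgue_measurable. Qed.

Lemma lebesgue_measurable_fun d' (T : measurableType d') (f : 'rV[R]_d -> T) :
  measurable_fun setT f -> measurable_fun setT (f : lebesgueR R d -> T).
Proof. by move=> mf; exact: (measurableT_comp mf lebesgue_measurable_id). Qed.

(** The identity is measurable from the Lebesgue to the Borel sigma-algebra and pushes [lebesgue]
    forward to [borel_lebesgue]. *)
Lemma ge0_integral_lebesgue (f : 'rV[R]_d -> \bar R) :
  measurable_fun setT f -> (forall x, 0 <= f x) ->
  \int[mu]_x f x = \int[lam d]_x f x.
Proof.
move=> mf f0.
transitivity (\int[pushforward mu (id : lebesgueR R d -> 'rV[R]_d)]_x f x).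
  rewrite (ge0_integral_pushforward lebesgue_measurable_id mu measurableT mf).
    by rewrite preimage_setT.
  by move=> x _; exact: f0.
pose m : {measure set 'rV[R]_d -> \bar R} :=
  measure_function_pushforward__canonical__measure_function_Measure
    mu lebesgue_measurable_id.
apply: (@eq_measure_integral _ _ _ _ (lam d) m) => A mA _.
exact: borel_lebesgueE.
Qed.

End lebesgue_space.

(** * The fractional kernel and the seminorm *)

Section dyadic.
Context (R : realType).

Lemma dyadic_shell (x : R) : 1 <= x -> exists j : nat, 2 ^+ j <= x < 2 ^+ j.+1.
Proof.
move=> x1.
have ex : exists j, x < 2 ^+ j.+1.
  exists (Num.trunc x).
  have /truncn_itv/andP[_ xt] : 0 <= x by exact: le_trans x1.
  apply: lt_le_trans xt _; rewrite -natrX ler_nat ltnW//.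
  by rewrite ltn_expl.
case: (ex_minnP ex) => j xj jmin; exists j; rewrite xj andbT.
case: j xj jmin => [|j] _ jmin; first by rewrite expr0.
by rewrite leNgt; apply/negP => /jmin; rewrite ltnn.
Qed.

Lemma nneseries_geometric_le (a z : R) : 0 <= a -> 0 < z < 1 ->
  (\sum_(0 <= j <oo) (a * z ^+ j)%:E <= (a / (1 - z))%:E)%E.
Proof.
move=> a0 /andP[z0 z1]; apply: lime_le.
  by apply: is_cvg_nneseries => n _ _; rewrite lee_fin mulr_ge0// exprn_ge0// ltW.
apply: nearW => n; rewrite sumEFin lee_fin -mulr_sumr ler_wpM2l//.
rewrite -[leRHS]mul1r ler_pdivlMr ?subr_gt0// big_mkord.
have := subrX1 z n; rewrite -opprB -[z - 1]opprB mulNr => /oppr_inj.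
by rewrite mulrC => <-; rewrite gerBl exprn_ge0// ltW.
Qed.

End dyadic.

Section kernel.
Context (R : realType) (d : nat) (s : R).
Hypotheses (s0 : 0 < s) (s1 : s < 1).
Local Notation lam := (borel_lebesgue R d).
Local Notation p := (d%:R + 2 * s).

Definition kernel (h : 'rV[R]_d) : R := (enorm h `^ p)^-1.

Lemma kernel_ge0 h : 0 <= kernel h.
Proof. by rewrite invr_ge0 powR_ge0. Qed.

Lemma kernelN h : kernel (- h) = kernel h.
Proof. by rewrite /kernel enormN. Qed.

Lemma kernel_exponent_gt0 : 0 < p.
Proof. by rewrite ltr_wpDl// mulr_gt0. Qed.

Lemma kernel_le h (t : R) : 0 < t <= `|h| -> kernel h <= (t `^ p)^-1.
Proof.
move=> /andP[t0 th]; rewrite lef_pV2 ?posrE ?powR_gt0//; last first.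
  by apply: lt_le_trans t0 (le_trans th (norm_le_enorm _)).
apply: ge0_ler_powR; rewrite ?nnegrE ?(ltW t0) ?enorm_ge0//.
  exact/ltW/kernel_exponent_gt0.
exact: le_trans th (norm_le_enorm _).
Qed.

Lemma kernel_ge h (t : R) : 0 < `|h| < t ->
  ((Num.sqrt d%:R * t) `^ p)^-1 <= kernel h.
Proof.
move=> /andP[h0 ht]; have e0 := lt_le_trans h0 (norm_le_enorm h).
have et : enorm h <= Num.sqrt d%:R * t.
  by apply: le_trans (enorm_le_norm h) _; rewrite ler_wpM2l ?sqrtr_ge0// ltW.
rewrite lef_pV2 ?posrE ?powR_gt0//; last exact: lt_le_trans et.
apply: ge0_ler_powR; rewrite ?nnegrE ?enorm_ge0//.
  exact/ltW/kernel_exponent_gt0.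
exact: le_trans (enorm_ge0 h) et.
Qed.

Lemma measurable_kernel : measurable_fun setT kernel.
Proof.
apply: (eq_measurable_fun (fun h : 'rV[R]_d => enorm h `^ (- p))).
  by move=> h _; rewrite powRN.
by apply: (measurableT_comp (measurable_powR _)); exact: measurable_enorm.
Qed.

Let b : R := 2 `^ (2 * s).

(** The lower bound comes from s > 0 and makes the outer dyadic shells summable; the upper bound
    comes from s < 1 and does the same for the inner ones. *)
Let b_itv : 1 < b < 4.
Proof.
have p1 (r : R) : 0 < r -> 1 < 4 `^ r :> R.
  move=> r0; have := @gt0_ltr_powR R r r0 1 4.
  by rewrite !nnegrE powR1 ler01 ler0n ltr1n => ->.
have bE : b = 4 `^ s by rewrite /b powRrM powR_mulrn// -natrX.
have e4 : 4 = 4 `^ (1 - s) * 4 `^ s :> R.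
  by rewrite -powRD ?subrK ?powRr1//; apply/implyP => _; rewrite pnatr_eq0.
by rewrite bE p1//= [ltRHS]e4 ltr_pMl ?powR_gt0// p1// subr_gt0.
Qed.

Let pow2p (j : nat) : (2 ^+ j) `^ p = (2 ^+ d * b) ^+ j :> R.
Proof.
rewrite -powR_mulrn// powRAC powR_mulrn ?powR_ge0//.
by rewrite powRD ?pnatr_eq0 ?implybT// powR_mulrn.
Qed.

Let ball2 (r : R) : 0 < r -> (2 * (2 * r)) ^+ d = 4 ^+ d * r ^+ d.
Proof. by move=> r0; rewrite mulrA -natrM exprMn. Qed.

(* The dyadic shell of radius 2^-j contributes O(2^(-j(2-2s))), the one of radius
   2^j contributes O(2^(-2sj)). *)
Lemma min_kernel_integrable (a : R) : 0 <= a ->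
  (\int[lam]_h (Num.min (a * dotv h h) 2 * kernel h)%:E < +oo)%E.
Proof.
move=> a0; have [b1 b4] := andP b_itv; have b0 : 0 < b := lt_trans ltr01 b1.
pose B := 2 ^+ d * b; have B0 : 0 < B by rewrite mulr_gt0// exprn_gt0.
(* [B] is 2^p. On 2^-(j+1) <= |h| <= 2^-j the minimum is at most a d 4^-j and the kernel at most
   B^(j+1), with product A (B/4)^j; on 2^j <= |h| < 2^(j+1) the two bounds are 2 and B^-j. *)
pose A := a * d%:R * B; have A0 : 0 <= A by rewrite !mulr_ge0 // ltW.
pose u j (h : 'rV[R]_d) := A * (B / 4) ^+ j * \1_(ball 0 (2 * 2 ^- j)) h.
pose v j (h : 'rV[R]_d) := 2 * B^-1 ^+ j * \1_(ball 0 (2 * 2 ^+ j)) h.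
pose g j h := (u j h + v j h)%:E.
have u0 j h : 0 <= u j h by rewrite !mulr_ge0 ?exprn_ge0 ?divr_ge0// ltW.
have v0 j h : 0 <= v j h by rewrite !mulr_ge0 ?exprn_ge0 ?invr_ge0// ltW.
have g0 j h : (0 <= g j h)%E by rewrite lee_fin addr_ge0.
have mind j r : measurable_fun setT (fun h : 'rV[R]_d => j * \1_(ball 0 r) h : R).
  by apply: measurable_funM => //; apply: measurable_indic; exact: measurable_ballv.
have mg j : measurable_fun setT (g j).
  by apply/measurable_EFinP; apply: measurable_funD; exact: mind.
have mf : measurable_fun setT (fun h : 'rV[R]_d => (Num.min (a * dotv h h) 2 * kernel h)%:E).
  apply/measurable_EFinP; apply: measurable_funM; last exact: measurable_kernel.
  apply: measurable_minr => //; apply: measurable_funM => //.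
  apply: (eq_measurable_fun (fun x : 'rV[R]_d => enorm x ^+ 2)).
    by move=> x _; rewrite sqr_enorm.
  by apply: measurable_funX; exact: measurable_enorm.
apply: (@le_lt_trans _ _ (\int[lam]_h \sum_(0 <= j <oo) g j h)%E).
  apply: ge0_le_integral => //.
  - move=> h _; rewrite lee_fin mulr_ge0 ?kernel_ge0// le_min ler0n andbT.
    by rewrite mulr_ge0// dotv_ge0.
  - exact: ge0_emeasurable_sum.
  move=> h _.
  have dom j : Num.min (a * dotv h h) 2 * kernel h <= u j h + v j h ->
      ((Num.min (a * dotv h h) 2 * kernel h)%:E <= \sum_(0 <= j <oo) g j h)%E.
    move=> H; apply: (@le_trans _ _ (g j h)); first by rewrite lee_fin.
    apply: le_trans (nneseries_lim_ge j.+1 _) => //.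
    by rewrite big_nat_recr//= leeDr// sume_ge0.
  (* At the origin the kernel takes the default value 0, the inverse of 0. *)
  have [h_0|hN0] := eqVneq h 0.
    apply: (dom 0%N); rewrite /kernel h_0.
    have -> : enorm (0 : 'rV[R]_d) = 0.
      by apply/eqP; rewrite -sqrf_eq0 sqr_enorm -(scale0r (0 : 'rV[R]_d)) dotvZl mul0r.
    by rewrite powR0 ?gt_eqF ?kernel_exponent_gt0// invr0 mulr0 addr_ge0.
  have h0 : 0 < `|h| by rewrite normr_gt0.
  have min0 : 0 <= Num.min (a * dotv h h) 2.
    by rewrite le_min ler0n andbT mulr_ge0// dotv_ge0.
  have [h1|h1] := ltP `|h| 1.
    have [j /andP[jh hj]] : exists j : nat, 2 ^+ j <= `|h|^-1 < 2 ^+ j.+1.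
      by apply: dyadic_shell; rewrite invf_ge1// ltW.
    apply: (dom j); apply: ler_wpDr => //.
    have hj' : 2 ^- j.+1 <= `|h|.
      by rewrite -[leRHS]invrK lef_pV2 ?posrE ?invr_gt0// ?exprn_gt0// ltW.
    have jh' : `|h| <= 2 ^- j.
      by rewrite -[leLHS]invrK lef_pV2 ?posrE ?invr_gt0// exprn_gt0.
    rewrite /u indicE mem_set ?mulr1; last first.
      rewrite ballvE/= sub0r normrN (le_lt_trans jh')//.
      have : 0 < 2 ^- j :> R by rewrite invr_gt0 exprn_gt0.
      by set t := 2 ^- j; lra.
    have -> : A * (B / 4) ^+ j = (a * d%:R * 2 ^- j ^+ 2) * B ^+ j.+1.
      have -> : 2 ^- j ^+ 2 = 4^-1 ^+ j :> R.
        by rewrite [LHS]exprVn [RHS]exprVn -exprM mulnC exprM -natrX.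
      by rewrite /A exprMn exprS; ring.
    apply: ler_pM; rewrite ?kernel_ge0//.
      apply: (@le_trans _ _ (a * dotv h h)); first by rewrite ge_min lexx.
      rewrite -mulrA ler_wpM2l// -sqr_enorm.
      apply: (@le_trans _ _ ((Num.sqrt d%:R * `|h|) ^+ 2)).
        by rewrite lerXn2r ?nnegrE ?enorm_ge0 ?mulr_ge0 ?sqrtr_ge0// enorm_le_norm.
      have t0 : 0 <= 2 ^- j :> R by rewrite invr_ge0 exprn_ge0.
      rewrite exprMn sqr_sqrtr ?ler0n//; apply: ler_wpM2l; first exact: ler0n.
      by apply: lerXn2r; rewrite ?nnegrE.
    have t0 : 0 < 2 ^- j.+1 :> R by rewrite invr_gt0 exprn_gt0.
    have := @kernel_le h (2 ^- j.+1); rewrite t0 hj' => /(_ isT).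
    have q0 : 0 <= 2 ^+ j.+1 :> R by rewrite exprn_ge0.
    have q1 : 0 <= (2 ^+ d * b) ^+ j.+1 :> R by rewrite exprn_ge0// ltW.
    by rewrite -(powR_inv1 q0) powRAC pow2p (powR_inv1 q1) invrK.
  have [j /andP[jh hj]] := dyadic_shell h1.
  apply: (dom j); apply: ler_wpDl => //.
  rewrite /v indicE mem_set ?mulr1; last first.
    by rewrite ballvE/= sub0r normrN -exprS.
  apply: ler_pM; rewrite ?kernel_ge0 ?ge_min ?lexx ?orbT//.
  have := @kernel_le h (2 ^+ j); rewrite exprn_gt0// jh => /(_ isT).
  by rewrite pow2p exprVn.
rewrite integral_nneseries//.
have ig j : (\int[lam]_h g j h = (A * 4 ^+ d * (b / 4) ^+ j)%:E
                              + (2 * 4 ^+ d * b^-1 ^+ j)%:E)%E.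
  have ii (c r : R) : 0 <= c -> 0 < r ->
      (\int[lam]_h (c * \1_(ball (0 : 'rV[R]_d) (2 * r)) h)%:E = (c * (4 ^+ d * r ^+ d))%:E)%E.
    move=> c0 r0; have mb := measurable_ballv (0 : 'rV[R]_d) (2 * r).
    under eq_integral do rewrite EFinM.
    rewrite ge0_integralZl_EFin//; last first.
      by apply/measurable_EFinP; exact: measurable_indic.
    rewrite (integral_indic lam measurableT mb) setIT.
    rewrite [X in (_ * X)%E](@borel_lebesgue_ball R d 0 (2 * r)) ?mulr_gt0//.
    by rewrite ball2.
  under eq_integral do rewrite /g EFinD.
  rewrite ge0_integralD//=.
  - rewrite /u /v ii ?mulr_ge0 ?exprn_ge0 ?divr_ge0 ?invr_gt0 ?exprn_gt0// ?ltW//.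
    rewrite ii ?exprn_gt0 ?mulr_ge0 ?exprn_ge0 ?invr_ge0 ?(ltW B0)//.
    have t0 : (2 ^+ j != 0 :> R) by rewrite expf_neq0.
    congr (_%:E + _%:E)%E.
      rewrite exprVn -exprM mulnC exprM /B !exprMn exprVn.
      by field; rewrite !expf_neq0.
    rewrite -exprM mulnC exprM /B invfM !exprMn !exprVn.
    by field; rewrite !expf_neq0// gt_eqF.
  - by move=> h _; rewrite lee_fin.
  - by apply/measurable_EFinP; exact: mind.
  - by move=> h _; rewrite lee_fin.
  - by apply/measurable_EFinP; exact: mind.
under eq_eseriesr do rewrite ig.
rewrite nneseriesD/=; last 2 first.
- by move=> j _ _; rewrite lee_fin !mulr_ge0 ?exprn_ge0 ?divr_ge0// ltW.
- by move=> j _ _; rewrite lee_fin !mulr_ge0 ?exprn_ge0 ?invr_ge0// ltW.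
apply: lte_add_pinfty.
  apply: (le_lt_trans (nneseries_geometric_le _ _)) (ltry _); first exact: mulr_ge0.
  by rewrite divr_gt0//= ltr_pdivrMr// mul1r.
apply: (le_lt_trans (nneseries_geometric_le _ _)) (ltry _); first exact: mulr_ge0.
by rewrite invr_gt0 b0 invf_lt1.
Qed.

End kernel.

(** * The seminorm as an integral over increments *)

Section seminorm.
Context (R : realType) (d : nat) (s : R).
Local Notation lam := (borel_lebesgue R d).
Implicit Types (u v w T : 'rV[R]_d -> R).
Local Open Scope ereal_scope.

(** The squared L^2 norm of the first increment of [v] by [h], possibly infinite. *)
Definition diff2 v (h : 'rV[R]_d) : \bar R := \int[lam]_x ((v (x + h) - v x) ^+ 2)%:E.

Lemma measurable_shift v (h : 'rV[R]_d) :
  measurable_fun setT v -> measurable_fun setT (fun x : 'rV[R]_d => v (x + h)%R).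
Proof. by move=> mv; apply: measurableT_comp => //; exact: measurable_addv. Qed.

Lemma measurable_translate2 v : measurable_fun setT v ->
  measurable_fun setT (fun z : 'rV[R]_d * 'rV[R]_d => v (z.2 + z.1)%R).
Proof. by move=> mv; apply: measurableT_comp => //; exact: measurable_addv. Qed.

Lemma measurable_diff2 v : measurable_fun setT v -> measurable_fun setT (diff2 v).
Proof.
move=> mv.
pose f (z : 'rV[R]_d * 'rV[R]_d) := ((v (z.2 + z.1) - v z.2) ^+ 2)%:E.
have f0 z : 0 <= f z by rewrite lee_fin sqr_ge0.
have mf : measurable_fun setT f.
  apply/measurable_EFinP; apply: measurable_funX; apply: measurable_funB.
    exact: (measurable_translate2 mv).
  by apply: measurableT_comp => //; exact: measurable_snd.
exact: (measurable_fun_fubini_tonelli_F f mf f0).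
Qed.

Definition Hs_density v (z : 'rV[R]_d * 'rV[R]_d) : \bar R :=
  (kernel s (z.1 - z.2) * (v z.1 - v z.2) ^+ 2)%:E.

Lemma Hs_density_ge0 v z : 0 <= Hs_density v z.
Proof. by rewrite lee_fin mulr_ge0 ?kernel_ge0 ?sqr_ge0. Qed.

Lemma measurable_Hs_density v : measurable_fun setT v ->
  measurable_fun setT (Hs_density v).
Proof.
move=> mv; apply/measurable_EFinP; apply: measurable_funM.
  have msub : measurable_fun setT (fun z : 'rV[R]_d * 'rV[R]_d => (z.1 - z.2)%R).
    by apply: measurable_addv => //; exact: measurable_oppv.
  exact: (measurableT_comp (@measurable_kernel R d s) msub).
apply: measurable_funX; apply: measurable_funB.
  by apply: measurableT_comp => //; exact: measurable_fst.
by apply: measurableT_comp => //; exact: measurable_snd.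
Qed.

Lemma Hs_seminorm2_density v : measurable_fun setT v ->
  Hs_seminorm2 s v = \int[lam]_x \int[lam]_y Hs_density v (x, y).
Proof.
move=> mv; set G := Hs_density v.
have G0 : forall z, 0 <= G z := Hs_density_ge0 v.
have mG : measurable_fun setT G := measurable_Hs_density mv.
have mG1 x : measurable_fun setT (fun y => G (x, y)).
  by apply: (measurableT_comp mG); exact: measurable_pair1.
rewrite -ge0_integral_lebesgue; last 2 first.
- exact: (measurable_fun_fubini_tonelli_F G mG G0).
- by move=> x; apply: integral_ge0 => y _; exact: G0.
apply: eq_integral => x _.
rewrite -(ge0_integral_lebesgue (mG1 x) (fun y => G0 _)).
apply: eq_integral => y _; congr EFin.
by rewrite /kernel mulrC real_normK// num_real.
Qed.

(** Substitution of y = x + h and exchange of the integrals. Estimates can then be made at fixed h,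
    where the integral over x is translation invariant. *)
Lemma Hs_seminorm2E v : measurable_fun setT v ->
  Hs_seminorm2 s v = \int[lam]_h ((kernel s h)%:E * diff2 v h).
Proof.
move=> mv; rewrite (Hs_seminorm2_density mv); set G := Hs_density v.
have G0 : forall z, 0 <= G z := Hs_density_ge0 v.
have mG1 x : measurable_fun setT (fun y => G (x, y)).
  by apply: (measurableT_comp (measurable_Hs_density mv)); exact: measurable_pair1.
pose H (z : 'rV[R]_d * 'rV[R]_d) : \bar R :=
  (kernel s z.1 * (v (z.2 + z.1) - v z.2) ^+ 2)%:E.
have H0 z : 0 <= H z by rewrite lee_fin mulr_ge0 ?kernel_ge0 ?sqr_ge0.
have mH : measurable_fun setT H.
  apply/measurable_EFinP; apply: measurable_funM.
    exact: (measurableT_comp (@measurable_kernel R d s) measurable_fst).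
  apply: measurable_funX; apply: measurable_funB.
    exact: (measurable_translate2 mv).
  by apply: measurableT_comp => //; exact: measurable_snd.
transitivity (\int[lam]_h \int[lam]_x H (h, x)).
  rewrite (fubini_tonelli H mH H0); apply: eq_integral => x _.
  rewrite -(ge0_integral_shift x (mG1 x) (fun y => G0 _)).
  apply: eq_integral => h _; congr EFin; rewrite /= opprD addrCA subrr addr0 kernelN.
  by rewrite -sqrrN opprB (addrC h x).
apply: eq_integral => h _; rewrite /H /=.
under eq_integral do rewrite EFinM.
have m2 : measurable_fun setT (fun x : 'rV[R]_d => ((v (x + h) - v x) ^+ 2)%:E).
  apply/measurable_EFinP; apply: measurable_funX; apply: measurable_funB; last by [].
  exact: (measurable_shift h mv).
have p2 x : 0 <= ((v (x + h)%R - v x) ^+ 2)%:E by rewrite lee_fin sqr_ge0.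
by rewrite (ge0_integralZl_EFin _ measurableT (fun x _ => p2 x) m2)// kernel_ge0.
Qed.

End seminorm.

(** * Truncation and level sets *)

Section truncation.
Context (R : realType).
Implicit Types (k l y z : R).

Definition clip k l z : R := Num.min (Num.max (z - k) 0) l.

Lemma clip_itv k l z : 0 <= l -> 0 <= clip k l z <= l.
Proof. by move=> l0; rewrite /clip le_min l0 le_max lexx orbT ge_min lexx orbT. Qed.

Lemma clip_gt0 k l z : 0 < l -> (0 < clip k l z) = (k < z).
Proof. by move=> l0; rewrite /clip lt_min l0 lt_max ltxx orbF subr_gt0 andbT. Qed.

Lemma clip_le k l z : 0 <= l -> k <= z -> clip k l z <= z - k.
Proof.
by move=> l0 kz; rewrite /clip ge_min (_ : Num.max _ _ = z - k) ?lexx// max_l// subr_ge0.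
Qed.

Lemma clip_eq k l z : k + l <= z -> 0 <= l -> clip k l z = l.
Proof.
move=> kz l0; have lz : l <= z - k by lra.
by rewrite /clip max_l ?min_r// (le_trans l0).
Qed.

Lemma clip_homo k l y z : y <= z -> 0 <= clip k l z - clip k l y <= z - y.
Proof.
move=> yz; rewrite /clip; case: (leP (z - k) 0) => ?; case: (leP (y - k) 0) => ?;
  case: (leP 0 l) => ?; case: (leP (z - k) l) => ?; case: (leP (y - k) l) => ?;
  apply/andP; split; lra.
Qed.

(** A nondecreasing 1-Lipschitz function has increments of the same sign as those of its argument
    and no larger in absolute value. *)
Lemma clip_slope k l y z :
  (clip k l z - clip k l y) ^+ 2 <= (clip k l z - clip k l y) * (z - y).
Proof.
rewrite expr2; have [yz|/ltW zy] := leP y z.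
  by have /andP[t0 t1] := clip_homo k l yz; rewrite ler_wpM2l.
have /andP[t0 t1] := clip_homo k l zy; rewrite -subr_ge0 -mulrBr.
move: t0 t1; set A := clip k l y; set B := clip k l z => t0 t1.
apply: mulr_le0; lra.
Qed.

End truncation.

Section ge0_integral_real.
Context dT (T : measurableType dT) (R : realType).
Context (m : {measure set T -> \bar R}) (D : set T) (mD : measurable D).
Implicit Types f g : T -> R.
Local Open Scope ereal_scope.

Lemma ge0_integralD_real f g : measurable_fun D f -> measurable_fun D g ->
  (forall x, 0 <= f x)%R -> (forall x, 0 <= g x)%R ->
  \int[m]_(x in D) (f x + g x)%:E =
  \int[m]_(x in D) (f x)%:E + \int[m]_(x in D) (g x)%:E.
Proof.
move=> mf mg f0 g0; under eq_integral do rewrite EFinD.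
apply: (ge0_integralD _ mD); first by move=> x _; rewrite lee_fin.
- exact/measurable_EFinP.
- by move=> x _; rewrite lee_fin.
- exact/measurable_EFinP.
Qed.

Lemma ge0_integralZ_real (a : R) f :
  measurable_fun D f -> (forall x, 0 <= f x)%R -> (0 <= a)%R ->
  \int[m]_(x in D) (a * f x)%:E = a%:E * \int[m]_(x in D) (f x)%:E.
Proof.
move=> mf f0 a0; under eq_integral do rewrite EFinM.
have mf' : measurable_fun D (fun x => (f x)%:E) by exact/measurable_EFinP.
by apply: (ge0_integralZl_EFin _ mD _ mf' a0) => x _; rewrite lee_fin.
Qed.

Lemma ge0_le_integral_real f g : measurable_fun D f -> measurable_fun D g ->
  (forall x, 0 <= f x)%R -> (forall x, D x -> f x <= g x)%R ->
  \int[m]_(x in D) (f x)%:E <= \int[m]_(x in D) (g x)%:E.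
Proof.
move=> mf mg f0 fg; apply: ge0_le_integral => //.
- by move=> x _; rewrite lee_fin.
- exact/measurable_EFinP.
- exact/measurable_EFinP.
Qed.

End ge0_integral_real.

(** * Effect of a truncation on the seminorm *)

Section truncation_energy.
Context (R : realType) (d : nat).
Local Notation lam := (borel_lebesgue R d).
Local Open Scope ereal_scope.
Let ge0_integralD_EFin := @ge0_integralD_real _ _ _ lam setT measurableT.
Let ge0_integralZ_EFin := @ge0_integralZ_real _ _ _ lam setT measurableT.
Let ge0_le_integral_EFin f g mf mg f0 fg :=
  @ge0_le_integral_real _ _ _ lam setT measurableT f g mf mg f0 (fun x _ => fg x).

Context (s a k l : R) (u psi : 'rV[R]_d -> R).
Hypotheses (s0 : (0 < s)%R) (s1 : (s < 1)%R) (a0 : (0 <= a)%R) (l0 : (0 < l)%R).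
Hypotheses (mu_ : measurable_fun setT u) (mpsi : measurable_fun setT psi).
Hypothesis psi01 : forall x, (0 <= psi x <= 1)%R.
Let c (h : 'rV[R]_d) : R := Num.min (a * dotv h h)%R 2%R.
Hypothesis psi_diff : forall x h,
  (psi (x + h) + psi (x - h) <= 2 * psi x + c h)%R.
Let T x := clip k l (u x - psi x).
Hypothesis Tfin : \int[lam]_x (T x)%:E < +oo.

Let T0 x : (0 <= T x)%R.
Proof. by have /andP[] := clip_itv k (u x - psi x) (ltW l0). Qed.

Let psi0 x : (0 <= psi x)%R. Proof. by have /andP[] := psi01 x. Qed.

Let mT : measurable_fun setT T.
Proof.
apply: measurable_minr => //; apply: measurable_maxr => //.
by apply: measurable_funB => //; apply: measurable_funB.
Qed.

Let c0 h : (0 <= c h)%R.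
Proof. by rewrite le_min ler0n andbT mulr_ge0// dotv_ge0. Qed.

(* Pointwise, with D the increment by h and T a 1-Lipschitz nondecreasing function
   of u - psi, (D u)^2 >= (D (u - T))^2 + (D T)^2 + 2 (D T) (D psi). Translation
   invariance turns the integral of the last term into that of T times a second
   difference of psi; as T psi is integrable, only nonnegative functions occur. *)
Lemma diff2_clip_le h :
  diff2 (fun x => u x - T x)%R h + diff2 T h <= diff2 u h + (2 * c h)%:E * \int[lam]_x (T x)%:E.
Proof.
have sh (v : 'rV[R]_d -> R) : measurable_fun setT v ->
    measurable_fun setT (fun x : 'rV[R]_d => v (x + h)%R).
  by move=> mv; exact: (measurable_shift h mv).
have sub_ (v w : 'rV[R]_d -> R) : measurable_fun setT v -> measurable_fun setT w ->
    measurable_fun setT (fun x : 'rV[R]_d => v x - w x : R)%R.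
  by move=> mv mw; apply: measurable_funB.
have mul_ (v w : 'rV[R]_d -> R) : measurable_fun setT v -> measurable_fun setT w ->
    measurable_fun setT (fun x : 'rV[R]_d => v x * w x : R)%R.
  by move=> mv mw; apply: measurable_funM.
have sq (v : 'rV[R]_d -> R) : measurable_fun setT v ->
    measurable_fun setT (fun x : 'rV[R]_d => (v (x + h) - v x) ^+ 2 : R)%R.
  by move=> mv; apply: measurable_funX; apply: (sub_ _ _ _ mv); exact: sh.
have muT : measurable_fun setT (fun x => u x - T x)%R by exact: sub_.
pose P := \int[lam]_x (T x * psi x)%:E.
pose I := \int[lam]_x (T x)%:E.
have I0 : 0 <= I by apply: integral_ge0 => x _; rewrite lee_fin.
have Tpsi0 x y : (0 <= T x * psi y)%R by rewrite mulr_ge0.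
have mTpsi : measurable_fun setT (fun x => T x * psi x)%R by exact: mul_.
have P0 : 0 <= P by apply: integral_ge0 => x _; rewrite lee_fin.
have Pfin : P \is a fin_num.
  rewrite ge0_fin_numE//; apply: le_lt_trans Tfin; apply: ge0_le_integral_EFin => // x.
  by rewrite ler_piMr//; have /andP[] := psi01 x.
pose Q1 := \int[lam]_x (T (x + h) * psi x)%:E.
pose Q2 := \int[lam]_x (T x * psi (x + h))%:E.
have mT_h : measurable_fun setT (fun x => T x * psi (x - h))%R.
  by apply: (mul_) => //; exact: (measurable_shift (- h)%R mpsi).
(* The shift is moved from [T] to [psi], so that [Q1 + Q2] becomes the integral of [T] against psi
   (x + h) + psi (x - h). *)
have Q1E : Q1 = \int[lam]_x (T x * psi (x - h))%:E.
  have mF : measurable_fun setT (fun x => (T x * psi (x - h))%:E) by exact/measurable_EFinP.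
  rewrite -(ge0_integral_shift h mF); last by move=> x; rewrite lee_fin.
  by apply: eq_integral => x _; rewrite addrK.
have Q12 : Q1 + Q2 <= 2%:E * P + (c h)%:E * I.
  rewrite Q1E -ge0_integralD_EFin//; last by apply: (mul_) => //; exact: sh.
  rewrite -ge0_integralZ_EFin// -ge0_integralZ_EFin// -ge0_integralD_EFin//.
  - apply: ge0_le_integral_EFin.
    + by apply: measurable_funD => //; apply: (mul_) => //; exact: sh.
    + by apply: measurable_funD; apply: (mul_).
    + by move=> x; rewrite addr_ge0.
    + by move=> x; have := ler_wpM2l (T0 x) (psi_diff x h); lra.
  - exact: mul_.
  - exact: mul_.
  - by move=> x; rewrite mulr_ge0.
  - by move=> x; rewrite mulr_ge0.
have PE : \int[lam]_x (T (x + h) * psi (x + h))%:E = P.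
  have mF : measurable_fun setT (fun x => (T x * psi x)%:E) by exact/measurable_EFinP.
  by rewrite /P -(ge0_integral_shift h mF)// => x; rewrite lee_fin.
have mthth : measurable_fun setT (fun x : 'rV[R]_d => 2 * (T (x + h) * psi (x + h)))%R.
  by apply: (mul_) => //; apply: (mul_); exact: sh.
have mtt : measurable_fun setT (fun x : 'rV[R]_d => 2 * (T x * psi x))%R.
  by apply: (mul_) => //; apply: (mul_).
have mtht : measurable_fun setT (fun x : 'rV[R]_d => 2 * (T (x + h) * psi x))%R.
  by apply: (mul_) => //; apply: (mul_) => //; exact: sh.
have mtth : measurable_fun setT (fun x : 'rV[R]_d => 2 * (T x * psi (x + h)))%R.
  by apply: (mul_) => //; apply: (mul_) => //; exact: sh.
have p2 x y : (0 <= 2 * (T x * psi y))%R by rewrite mulr_ge0.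
have z2 (f : 'rV[R]_d -> R) : measurable_fun setT (fun x => 2 * f x)%R ->
    (forall x, 0 <= f x)%R -> \int[lam]_x (2 * f x)%:E = 2%:E * \int[lam]_x (f x)%:E.
  move=> mf f0; apply: ge0_integralZ_EFin => //.
  rewrite (_ : f = (fun x => 2^-1 * (2 * f x))%R); first exact: mul_.
  by apply/funext => x; rewrite mulrA mulVf ?mul1r.
(* The term 2 (D T) (D psi) is multiplied out; its two positive products, each with integral 2 P,
   stand on the left and its two negative ones on the right. *)
have main : diff2 (fun x => u x - T x)%R h + diff2 T h + (2%:E * P + 2%:E * P) <=
    diff2 u h + (2%:E * Q1 + 2%:E * Q2).
  rewrite -{1}PE /P /Q1 /Q2 -!z2// /diff2.
  have sqr0 (v : 'rV[R]_d -> R) x : (0 <= (v (x + h) - v x) ^+ 2)%R by rewrite sqr_ge0.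
  rewrite -(ge0_integralD_EFin mthth mtt (fun x => p2 _ _) (fun x => p2 _ _)).
  rewrite -(ge0_integralD_EFin mtht mtth (fun x => p2 _ _) (fun x => p2 _ _)).
  pose g1 x := (2 * (T (x + h) * psi (x + h)) + 2 * (T x * psi x))%R.
  pose g2 x := (2 * (T (x + h) * psi x) + 2 * (T x * psi (x + h)))%R.
  have mg1 : measurable_fun setT g1 := measurable_funD mthth mtt.
  have mg2 : measurable_fun setT g2 := measurable_funD mtht mtth.
  have g10 x : (0 <= g1 x)%R by rewrite addr_ge0.
  have g20 x : (0 <= g2 x)%R by rewrite addr_ge0.
  have mB := sq _ muT; have mC := sq _ mT; have mA := sq _ mu_.
  pose BC x := ((u (x + h) - T (x + h) - (u x - T x)) ^+ 2 + (T (x + h) - T x) ^+ 2)%R.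
  have mBC : measurable_fun setT BC := measurable_funD mB mC.
  have BC0 x : (0 <= BC x)%R by rewrite addr_ge0 ?sqr_ge0.
  have E1 := ge0_integralD_EFin mB mC (sqr0 _) (sqr0 _).
  have E2 := ge0_integralD_EFin mBC mg1 BC0 g10.
  have E3 := ge0_integralD_EFin mA mg2 (sqr0 _) g20.
  rewrite [X in X + _ <= _](esym E1) [X in X <= _](esym E2) [X in _ <= X](esym E3).
  apply: ge0_le_integral_EFin.
  - exact: measurable_funD.
  - exact: measurable_funD.
  - by move=> x; exact: (addr_ge0 (BC0 x) (g10 x)).
  - move=> x; rewrite /BC /g1 /g2.
    have := clip_slope k l (u x - psi x) (u (x + h)%R - psi (x + h)%R).
    by rewrite -/(T x) -/(T (x + h)%R); nra.
(* Only the finiteness of [P] is used for the cancellation: [diff2 u h] may be infinite. *)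
rewrite -(@leeD2rE _ (2%:E * P + 2%:E * P)); last by rewrite !fin_numD !fin_numM.
apply: le_trans main _; move: (diff2 u h) => A; rewrite -addeA; apply: leeD2l.
have Ifin : I \is a fin_num by rewrite ge0_fin_numE.
have [Q10 Q20] : 0 <= Q1 /\ 0 <= Q2.
  by split; apply: integral_ge0 => x _; rewrite lee_fin.
rewrite -ge0_muleDr//; apply: (@le_trans _ _ (2%:E * (2%:E * P + (c h)%:E * I))).
  exact: lee_wpmul2l.
rewrite -/I; clearbody I P.
move: Ifin Pfin => /fineK <- /fineK <-.
change ((2 * (2 * fine P + c h * fine I))%:E <=
  (2 * c h * fine I + (2 * fine P + 2 * fine P))%:E).
by rewrite lee_fin; lra.
Qed.

(** [diff2_clip_le] integrated against the kernel. The error is a multiple of the integral of [T],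
    the same quantity that the fidelity term gains, so it can be absorbed. *)
Lemma Hs_seminorm2_clip_le :
  Hs_seminorm2 s (fun x => u x - T x)%R + Hs_seminorm2 s T <=
  Hs_seminorm2 s u + 2%:E * (\int[lam]_h (c h * kernel s h)%:E) * \int[lam]_x (T x)%:E.
Proof.
have muT : measurable_fun setT (fun x => u x - T x)%R by exact: measurable_funB.
pose I := \int[lam]_x (T x)%:E.
have I0 : 0 <= I by apply: integral_ge0 => x _; rewrite lee_fin.
have Ifin : I \is a fin_num by rewrite ge0_fin_numE.
have mK : measurable_fun setT (fun h => (@kernel R d s h)%:E).
  by apply/measurable_EFinP; exact: measurable_kernel.
have K0 h : 0 <= (@kernel R d s h)%:E by rewrite lee_fin kernel_ge0.
have d0 (v : 'rV[R]_d -> R) h : 0 <= diff2 v h.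
  by apply: integral_ge0 => x _; rewrite lee_fin sqr_ge0.
have mKd (v : 'rV[R]_d -> R) : measurable_fun setT v ->
    measurable_fun setT (fun h => (kernel s h)%:E * diff2 v h).
  by move=> mv; apply: emeasurable_funM => //; exact: (measurable_diff2 mv).
have mc : measurable_fun setT (fun h => c h * kernel s h)%R.
  apply: measurable_funM; last exact: measurable_kernel.
  apply: measurable_minr => //; apply: measurable_funM => //.
  apply: (eq_measurable_fun (fun x : 'rV[R]_d => enorm x ^+ 2)%R).
    by move=> x _; rewrite sqr_enorm.
  by apply: measurable_funX; exact: measurable_enorm.
have ck0 h : (0 <= c h * kernel s h)%R by rewrite mulr_ge0 ?kernel_ge0.
have i0 : (0 <= 2 * fine I)%R by rewrite mulr_ge0// fine_ge0.
have -> : 2%:E * (\int[lam]_h (c h * kernel s h)%:E) * \int[lam]_x (T x)%:E =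
    \int[lam]_h (2 * fine I * (c h * kernel s h))%:E.
  by rewrite ge0_integralZ_EFin// -/I -{1}(fineK Ifin) EFinM muleAC.
rewrite !Hs_seminorm2E//.
rewrite -(ge0_integralD _ measurableT); last 4 first.
- by move=> h _; rewrite mule_ge0.
- exact: mKd.
- by move=> h _; rewrite mule_ge0.
- exact: mKd.
rewrite -(ge0_integralD _ measurableT); last 4 first.
- by move=> h _; rewrite mule_ge0.
- exact: mKd.
- by move=> h _; rewrite lee_fin mulr_ge0.
- by apply/measurable_EFinP; exact: measurable_funM.
apply: ge0_le_integral; first exact: measurableT.
- by move=> h _; rewrite adde_ge0// mule_ge0.
- by apply: emeasurable_funD; exact: mKd.
- by apply: emeasurable_funD; [exact: mKd|apply/measurable_EFinP; exact: measurable_funM].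
move=> h _; rewrite -ge0_muleDr//.
apply: (le_trans (lee_wpmul2l (K0 h) (diff2_clip_le h))).
rewrite ge0_muleDr// ?mule_ge0 ?lee_fin ?mulr_ge0//; apply: leeD2l.
by rewrite -/I -(fineK Ifin) -!EFinM lee_fin; lra.
Qed.

End truncation_energy.

(** * A lower bound for the seminorm of a truncation *)

Section seminorm_lower_bound.
Context (R : realType) (d : nat) (s : R).
Local Notation lam := (borel_lebesgue R d).
Local Notation p := (d%:R + 2 * s)%R.
Hypotheses (s0 : 0 < s).

(* Lower bound for the mass that the kernel gives to the part of a ball of
   radius r outside a set that fills at most half of it. *)
Definition ball_mass (r : R) : R := ((Num.sqrt d%:R * r) `^ p)^-1 * ((2 * r) ^+ d / 2).

Lemma ball_mass_ge0 r : 0 <= r -> 0 <= ball_mass r.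
Proof.
by move=> r0; rewrite mulr_ge0 ?invr_ge0 ?powR_ge0 ?divr_ge0 ?exprn_ge0// mulr_ge0.
Qed.

Local Open Scope ereal_scope.

(** Only the pairs with x in [A] and y outside [B] in the cube of radius r about x are kept. There
    [T] drops from l to 0, and the kernel is at least its value at distance sqrt d r, which bounds
    the Euclidean length within the cube. *)
Lemma Hs_seminorm2_ge (T : 'rV[R]_d -> R) (A B : set 'rV[R]_d) (l r : R) :
  measurable_fun setT T -> measurable A -> measurable B -> A `<=` B ->
  (forall x, A x -> T x = l) -> (forall x, ~ B x -> T x = 0%R) ->
  (0 < r)%R -> lam B <= ((2 * r) ^+ d / 2)%:E ->
  (l ^+ 2 * ball_mass r)%:E * lam A <= Hs_seminorm2 s T.
Proof.
move=> mT mA mB AB TA TB r0 lB.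
have l2 : (0 <= l ^+ 2)%R by rewrite sqr_ge0.
have bm0 := ball_mass_ge0 (ltW r0).
rewrite (Hs_seminorm2_density s mT).
have indicZ (a : R) (E : set 'rV[R]_d) : (0 <= a)%R -> measurable E ->
    \int[lam]_x (a * \1_E x)%:E = a%:E * lam E.
  move=> a0 mE; have m1 : measurable_fun setT (\1_E : 'rV[R]_d -> R) by exact: measurable_indic.
  have p1 x : (0 <= (\1_E x : R))%R by [].
  by rewrite (ge0_integralZ_real lam measurableT m1 p1 a0)
    (integral_indic lam measurableT mE) setIT.
have -> : (l ^+ 2 * ball_mass r)%:E * lam A =
    \int[lam]_x ((l ^+ 2 * ball_mass r) * \1_A x)%:E.
  by rewrite indicZ// mulr_ge0.
apply: ge0_le_integral; first exact: measurableT.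
- by move=> x _; rewrite lee_fin; apply: mulr_ge0 => //; apply: mulr_ge0.
- by apply/measurable_EFinP; apply: measurable_funM => //; exact: measurable_indic.
- exact: (measurable_fun_fubini_tonelli_F _ (measurable_Hs_density s mT)
    (Hs_density_ge0 s T)).
move=> x _; rewrite indicE; have [Ax|nAx] := boolP (x \in A); last first.
  by rewrite mulr0; apply: integral_ge0 => y _; exact: Hs_density_ge0.
rewrite mulr1; rewrite inE in Ax.
pose E := ball x r `\` B.
have mb := measurable_ballv x r.
have mE : measurable E by exact: measurableD.
pose t := ((Num.sqrt d%:R * r) `^ p)^-1%R.
have t0 : (0 <= t)%R by rewrite invr_ge0 powR_ge0.
apply: (@le_trans _ _ (\int[lam]_y ((l ^+ 2 * t) * \1_E y)%:E)).
  rewrite (indicZ _ _ (mulr_ge0 l2 t0) mE) /ball_mass mulrA EFinM.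
  apply: lee_wpmul2l; first by rewrite lee_fin mulr_ge0.
  have := borel_lebesgue_ball x r0; rewrite (measureDI _ mb mB) -/E => lE.
  have lBr : lam (ball x r `&` B) <= ((2 * r) ^+ d / 2)%:E.
    by apply: le_trans lB; apply: le_measure; rewrite ?inE//; exact: measurableI.
  rewrite -(@leeD2rE _ ((2 * r) ^+ d / 2)%:E)//.
  rewrite -EFinD -splitr -lE; exact: leeD2l.
apply: ge0_le_integral; first exact: measurableT.
- by move=> y _; rewrite lee_fin; apply: mulr_ge0 => //; apply: mulr_ge0.
- by apply/measurable_EFinP; apply: measurable_funM => //; exact: measurable_indic.
- by apply: (measurableT_comp (measurable_Hs_density s mT)); exact: measurable_pair1.
move=> y _; rewrite indicE; have [Ey|nEy] := boolP (y \in E); last first.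
  by rewrite mulr0; exact: Hs_density_ge0.
rewrite inE in Ey; have [xy nBy] := Ey; rewrite mulr1 /Hs_density/= lee_fin.
rewrite (TA _ Ax) (TB _ nBy) subr0 mulrC ler_wpM2r//; apply: kernel_ge => //.
apply/andP; split; last by move: xy; rewrite ballvE.
(* The points differ because [A] is contained in [B]; this avoids the value 0 of the kernel at the
   origin. *)
by rewrite normr_gt0 subr_eq0; apply/eqP => xy'; apply: nBy; rewrite -xy'; exact: AB.
Qed.

End seminorm_lower_bound.

(** * Decay of the volumes of the level sets *)

Section iteration.
Context (R : realType) (d : nat) (s q : R).
Hypotheses (d0 : (0 < d)%N) (s0 : 0 < s) (dq : d%:R / (2 * s) < q).

Let q0 : 0 < q.
Proof. by apply: le_lt_trans dq; rewrite divr_ge0// mulr_ge0// ltW. Qed.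

Let delta : R := 2 * s - d%:R / q.

Let delta0 : 0 < delta.
Proof. by rewrite subr_gt0 ltr_pdivrMr// mulrC -ltr_pdivrMr// mulr_gt0. Qed.

Let tau : R := 2^-1 `^ delta^-1.

Let tau_itv : 0 < tau < 1.
Proof.
rewrite powR_gt0 ?invr_gt0//=; have := @gt0_ltr_powR R delta^-1 _ 2^-1 1.
by rewrite !nnegrE powR1 invr_gt0 invr_ge0 invf_lt1 ?ltr1n// => ->.
Qed.

Let tau_delta (j : nat) (r0 : R) : 0 <= r0 ->
  (r0 * tau ^+ j) `^ delta = r0 `^ delta / 2 ^+ j.
Proof.
move=> r00; have t0 : 0 <= tau by rewrite ltW//; have /andP[] := tau_itv.
rewrite powRM ?exprn_ge0//; congr (_ * _).
have td : tau `^ delta = 2^-1.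
  by rewrite /tau -powRrM mulVf ?gt_eqF// powRr1// invr_ge0.
by rewrite -[tau ^+ j]powR_mulrn// powRAC td powR_mulrn ?invr_ge0// exprVn.
Qed.

(* delta = 2s - d/q > 0 makes the exponent in the level inequality superlinear, and
   t is chosen with t^delta = 1/2 to absorb the factor 2^j coming from the gap
   e / 2^(j+1) between consecutive levels. *)
Lemma geometric_level_decay (r0 : R) : 0 < r0 ->
  exists K t : R, [/\ 0 < K, 0 < t < 1 & forall (N alpha e y : R) (j : nat),
    0 < alpha -> 0 < e -> N / alpha <= K * e ->
    alpha * (e / 2 ^+ j.+1) * ball_mass d s (r0 * t ^+ j) * y <=
      2 * N * ((2 * (r0 * t ^+ j)) ^+ d / 2) `^ (1 - q^-1) ->
    y <= (2 * (r0 * t ^+ j.+1)) ^+ d / 2].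
Proof.
move=> r00; have /andP[t0 t1] := tau_itv.
pose M : R := 2 ^+ d / 2; have M0 : 0 < M by rewrite divr_gt0// exprn_gt0.
pose Sd : R := Num.sqrt d%:R `^ (d%:R + 2 * s).
have Sd0 : 0 < Sd by rewrite powR_gt0// sqrtr_gt0 ltr0n.
pose Mq : R := M `^ q^-1; have Mq0 : 0 < Mq by rewrite powR_gt0.
pose r0d : R := r0 `^ delta; have r0d0 : 0 < r0d by rewrite powR_gt0.
(* Once the powers of r and 2^j are cancelled, the hypothesis reads alpha e y <= N (4 Sd r0d / Mq) x
   with x = r^d, and the goal is y <= M tau^d x; [K] is the constant that turns the first into the
   second. *)
exists (M * tau ^+ d * Mq / (4 * Sd * r0d)), tau; split=> [| |N alpha e y j alpha0 e0].
- by rewrite divr_gt0 ?mulr_gt0 ?exprn_gt0.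
- exact: tau_itv.
rewrite ler_pdivrMr// => NK.
have tj0 : 0 < tau ^+ j by rewrite exprn_gt0.
have := tau_delta j (ltW r00); set r := r0 * tau ^+ j => rdelta.
have r_gt0 : 0 < r by rewrite mulr_gt0.
have -> : r0 * tau ^+ j.+1 = r * tau by rewrite /r exprSr mulrA.
pose v : R := r `^ (d%:R / q); have v0 : 0 < v by rewrite powR_gt0.
pose x : R := r ^+ d; have x0 : 0 < x by rewrite exprn_gt0.
pose t : R := 2 ^+ j; have tt0 : 0 < t by rewrite exprn_gt0.
have muE : (2 * r) ^+ d / 2 = M * x by rewrite exprMn /M mulrAC.
have rN0 : r != 0 by rewrite gt_eqF.
have bmE : ball_mass d s r = (Sd * (x * (r0d / t * v)))^-1 * (M * x).
  rewrite /ball_mass muE powRM ?sqrtr_ge0 ?(ltW r_gt0)//; congr (_^-1 * _); congr (_ * _).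
  rewrite powRD ?rN0 ?implybT// powR_mulrn ?(ltW r_gt0)//; congr (_ * _).
  by rewrite -rdelta /v -powRD ?rN0 ?implybT// /delta subrK.
have powE : (M * x) `^ (1 - q^-1) = M * x / (Mq * v).
  have Mx0 : 0 < M * x by rewrite mulr_gt0.
  rewrite powRB ?(gt_eqF Mx0) ?implybT// powRr1 ?(ltW Mx0)//.
  have xq : x `^ q^-1 = v by rewrite /x -(powR_mulrn _ (ltW r_gt0)) -powRrM.
  by rewrite (powRM _ (ltW M0) (ltW x0)) xq.
rewrite bmE muE powE => H.
(* The factor that clears the denominators; it sets the 2^j of the level gap against the one in
   r^delta = r0^delta / 2^j. *)
have c0 : 0 < 2 * t * Sd * (r0d / t) * v / M.
  by rewrite !mulr_gt0 ?invr_gt0.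
move: H; rewrite -(ler_pM2r c0).
have -> : alpha * (e / 2 ^+ j.+1) * ((Sd * (x * (r0d / t * v)))^-1 * (M * x)) * y *
    (2 * t * Sd * (r0d / t) * v / M) = alpha * e * y.
  by rewrite exprS -/t; field; rewrite !gt_eqF.
have -> : 2 * N * (M * x / (Mq * v)) * (2 * t * Sd * (r0d / t) * v / M) =
    N * (4 * Sd * r0d / Mq) * x.
  by field; rewrite !gt_eqF.
move=> H; have -> : (2 * (r * tau)) ^+ d / 2 = M * tau ^+ d * x.
  by rewrite mulrA exprMn mulrAC muE mulrAC.
rewrite -(ler_pM2l (mulr_gt0 alpha0 e0)); apply: (le_trans H).
rewrite [leRHS]mulrA ler_pM2r//.
have D0 : 0 < 4 * Sd * r0d / Mq by rewrite divr_gt0 ?mulr_gt0.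
apply: (le_trans (ler_wpM2r (ltW D0) NK)).
rewrite le_eqVlt; apply/orP; left; apply/eqP; field.
by rewrite !gt_eqF.
Qed.

End iteration.

Lemma geometric_le0 (R : realType) (y C t : R) : 0 < t < 1 ->
  (forall j : nat, y <= C * t ^+ j) -> y <= 0.
Proof.
move=> /andP[t0 t1] yC.
have cv : C * t ^+ j @[j --> \oo] --> (0 : R).
  rewrite -[X in _ --> X](mulr0 C); apply: cvgMr.
  by apply: cvg_expr; rewrite gtr0_norm.
apply: (cvgr_to_ge cv); exact: nearW.
Qed.

(** * Comparison of the energies of u and u - T *)

Section energy_balance.
Context (R : realType).
Local Open Scope ereal_scope.

(** [E1], [E2] stand for the fidelity terms of u and u - T; [HU], [HV], [HT] for the seminorms of u,
    u - T and T; [I] and [N] for the integrals of T and |n| T; [C] for the integral of the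
    second-difference bound against the kernel. An infinite [N] makes the claim trivial; otherwise
    all terms are finite and the claim is linear arithmetic. *)
Lemma energy_balance (alpha k : R) (E1 E2 N I C HU HV HT : \bar R) :
  (0 < alpha)%R -> (0 <= k)%R -> 0 <= E1 -> E1 < +oo -> 0 <= E2 -> 0 <= N ->
  0 <= I -> I < +oo -> 0 <= C -> C \is a fin_num -> 0 <= HU -> HU < +oo -> 0 <= HV -> 0 <= HT ->
  E2 + (2 * k)%:E * I <= E1 + 2%:E * N ->
  E1 + alpha%:E * HU <= E2 + alpha%:E * HV ->
  HV + HT <= HU + 2%:E * C * I -> (alpha * fine C <= k)%R ->
  alpha%:E * HT <= 2%:E * N.
Proof.
move=> alpha0 k0 E10 E1oo E20 N0 I0 Ioo C0 Cfin HU0 HUoo HV0 HT0.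
have [->|Nfin] := eqVneq N +oo; first by rewrite gt0_muley ?lte_fin// leey.
have {}Nfin : N \is a fin_num by rewrite ge0_fin_numE// ltey.
have E1fin : E1 \is a fin_num by rewrite ge0_fin_numE.
have Ifin : I \is a fin_num by rewrite ge0_fin_numE.
have HUfin : HU \is a fin_num by rewrite ge0_fin_numE.
move=> E21 HUV HVT aC.
have E2fin : E2 \is a fin_num.
  rewrite ge0_fin_numE//; apply: (@le_lt_trans _ _ (E1 + 2%:E * N)).
    by apply: le_trans E21; rewrite leeDl// mule_ge0// lee_fin mulr_ge0.
  by rewrite -(fineK E1fin) -(fineK Nfin) -EFinM -EFinD ltry.
have HVTfin : HV + HT < +oo.
  by apply: (le_lt_trans HVT); rewrite -(fineK HUfin) -(fineK Cfin) -(fineK Ifin)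
    -!EFinM -EFinD ltry.
have HVfin : HV \is a fin_num.
  by rewrite ge0_fin_numE//; apply: le_lt_trans HVTfin; rewrite leeDl.
have HTfin : HT \is a fin_num.
  by rewrite ge0_fin_numE//; apply: le_lt_trans HVTfin; rewrite leeDr.
have I0' := fine_ge0 I0; move: E21 HUV HVT.
rewrite -(fineK E1fin) -(fineK E2fin) -(fineK Nfin) -(fineK Ifin) -(fineK Cfin).
rewrite -(fineK HUfin) -(fineK HVfin) -(fineK HTfin) -!EFinM -!EFinD !lee_fin.
move=> h1 h2 /(ler_wpM2l (ltW alpha0)) h3; have := ler_wpM2r I0' aC; lra.
Qed.

End energy_balance.

(* u minimizes the functional J with data g + n, and psi + b is a barrier above g. Both
   signs of the original problem are covered: (g, b) = (1_D, 0) bounds u from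
   above, and (-1_D, -1), with -u and -n, bounds it from below. *)
Section barrier_comparison.
Context (R : realType) (d : nat).
Local Notation lam := (borel_lebesgue R d).
Local Notation mu := (lebesgue R d).
Context (s a b alpha : R) (Omega : set 'rV[R]_d) (u psi g n : 'rV[R]_d -> R).
Hypotheses (s0 : (0 < s)%R) (s1 : (s < 1)%R) (a0 : (0 <= a)%R).
Hypotheses (alpha0 : (0 < alpha)%R).
Hypotheses (mOmega : measurable Omega) (finOmega : (lam Omega < +oo)%E).
Hypotheses (mu_ : measurable_fun setT u) (u0 : forall x, ~ Omega x -> u x = 0%R).
Hypothesis Hs_u : (Hs_seminorm2 s u < +oo)%E.
Hypotheses (mpsi : measurable_fun setT psi) (psi01 : forall x, (0 <= psi x <= 1)%R).
Let c (h : 'rV[R]_d) : R := Num.min (a * dotv h h)%R 2%R.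
Hypothesis psi_diff : forall x h,
  (psi (x + h) + psi (x - h) <= 2 * psi x + c h)%R.
Hypotheses (mg : measurable_fun setT g) (g1 : forall x, (`|g x| <= 1)%R).
Hypothesis n2 : in_Lp Omega 2 n.
Hypothesis g_psi : forall x, Omega x -> (g x <= psi x + b)%R.
Hypothesis psi_out : forall x, ~ Omega x -> (0 <= psi x + b)%R.
Local Open Scope ereal_scope.
Let J (v : 'rV[R]_d -> R) :=
  \int[mu]_(x in Omega) ((v x - g x - n x) ^+ 2)%:E + alpha%:E * Hs_seminorm2 s v.
Hypothesis min_u : forall v, Hs0 s Omega v -> J u <= J v.

Let mlevel t : measurable [set x | t < u x - psi x]%R.
Proof.
have mup : measurable_fun setT (fun x => u x - psi x)%R by exact: measurable_funB.
rewrite -[X in measurable X]setTI.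
have := mup measurableT `]t, +oo[%classic (measurable_itv _).
by congr measurable; apply/seteqP; split => x /= [_]; rewrite in_itv/= andbT.
Qed.

Section level.
Context (k l : R).
Hypotheses (l0 : (0 < l)%R) (k0 : (0 <= k)%R).
Hypothesis alpha_k : (alpha * fine (\int[lam]_h (c h * kernel s h)%:E)%E <= k)%R.
Let T x := clip (k + b)%R l (u x - psi x)%R.

Let T0 x : (0 <= T x)%R.
Proof. by have /andP[] := clip_itv (k + b)%R (u x - psi x)%R (ltW l0). Qed.

Let Tl x : (T x <= l)%R.
Proof. by have /andP[] := clip_itv (k + b)%R (u x - psi x)%R (ltW l0). Qed.

(** Makes u - T admissible: outside [Omega] the value 0 of u does not exceed the barrier psi + b. *)
Let T_out x : ~ Omega x -> T x = 0%R.
Proof.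
move=> nx; apply/eqP; rewrite eq_le T0 andbT leNgt (clip_gt0 _ _ l0) -leNgt.
have := psi_out nx; have := k0; rewrite (u0 nx) => k0' p0; lra.
Qed.

Let mT : measurable_fun setT T.
Proof.
apply: measurable_minr => //; apply: measurable_maxr => //.
by apply: measurable_funB => //; apply: measurable_funB.
Qed.

Let mOm : measurable (Omega : set (lebesgueR R d)) := lebesgue_measurable mOmega.

Let mL (f : 'rV[R]_d -> R) : measurable_fun setT f ->
  measurable_fun (Omega : set (lebesgueR R d)) (f : lebesgueR R d -> R).
Proof. by move=> mf; apply: measurable_funTS; exact: lebesgue_measurable_fun. Qed.

Lemma in_Lp_measurable (q : R) (f : 'rV[R]_d -> R) : in_Lp Omega q f ->
  measurable_fun (Omega : set (lebesgueR R d)) (f : lebesgueR R d -> R).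
Proof.
rewrite /in_Lp inE => /andP[+ _]; rewrite inE/= => mf.
exact: (iffRL (measurable_restrictT (f : lebesgueR R d -> R) mOm) mf).
Qed.

Let mn := in_Lp_measurable n2.

Let mresidual (v : 'rV[R]_d -> R) : measurable_fun setT v ->
  measurable_fun (Omega : set (lebesgueR R d))
    (fun x : lebesgueR R d => (v x - g x - n x) ^+ 2 : R)%R.
Proof.
by move=> mv; exact: (measurable_funX 2 (measurable_funB (measurable_funB (mL mv) (mL mg)) mn)).
Qed.

Let mn2 : measurable_fun (Omega : set (lebesgueR R d))
  (fun x : lebesgueR R d => 2 * n x ^+ 2 : R)%R.
Proof.
have m2 : measurable_fun (Omega : set (lebesgueR R d)) (cst 2%R : lebesgueR R d -> R).
  exact: measurable_cst.
exact: (measurable_funM m2 (measurable_funX 2 mn)).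
Qed.

Let muOmega : mu Omega = lam Omega := borel_lebesgueE mOmega.

Let n2_fin : \int[mu]_(x in Omega) ((n x) ^+ 2)%:E < +oo.
Proof.
have /Lfun2_integrable_sqr/integrableP[_ /=] := n2.
apply: le_lt_trans; rewrite integral_mkcond le_eqVlt; apply/orP; left; apply/eqP.
apply: eq_integral => x _; rewrite patchE ger0_norm ?sqr_ge0//.
by rewrite /zero_ext /patch; case: ifPn => _ //=; rewrite expr0n.
Qed.

Let Tint : \int[lam]_x (T x)%:E = \int[mu]_(x in Omega) (T x)%:E.
Proof.
rewrite -ge0_integral_lebesgue; [|exact/measurable_EFinP|by move=> x; rewrite lee_fin].
rewrite [RHS]integral_mkcond; apply: eq_integral => x _; rewrite patchE.
by case: ifPn => // /negP; rewrite inE => /T_out ->.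
Qed.

Let Tfin : \int[lam]_x (T x)%:E < +oo.
Proof.
rewrite Tint; apply: (@le_lt_trans _ _ (\int[mu]_(x in Omega) (cst l x)%:E)).
  by apply: (ge0_le_integral_real mu mOm) => //; exact: mL.
rewrite (integral_cst mu mOm l%:E) muOmega; apply: lte_mul_pinfty => //.
by rewrite lee_fin ltW.
Qed.

(** By comparison with the zero function, whose energy, the integral of (g + n)^2, is at most that
    of 2 + 2 n^2. *)
Let E1fin : \int[mu]_(x in Omega) ((u x - g x - n x) ^+ 2)%:E < +oo.
Proof.
have H00 : Hs_seminorm2 s (cst 0%R : 'rV[R]_d -> R) = 0.
  rewrite /Hs_seminorm2; apply: integral0_eq => x _; apply: integral0_eq => y _.
  by rewrite subrr normr0 expr0n mul0r.
have : J u <= J (cst 0%R).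
  apply: min_u; split; [exact: measurable_cst|by []|].
  by rewrite H00; exact: ltry.
rewrite /J H00 mule0 adde0 => J0; apply: (@le_lt_trans _ _ (J u)).
  rewrite leeDl// mule_ge0 ?lee_fin ?(ltW alpha0)//.
  by apply: integral_ge0 => x _; apply: integral_ge0 => y _;
    rewrite lee_fin mulr_ge0 ?invr_ge0 ?powR_ge0 ?exprn_ge0.
apply: (le_lt_trans J0).
have m2 : measurable_fun (Omega : set (lebesgueR R d)) (cst 2%R : lebesgueR R d -> R).
  exact: measurable_cst.
apply: (@le_lt_trans _ _ (\int[mu]_(x in Omega) (cst 2 x + 2 * n x ^+ 2)%:E)).
  apply: (ge0_le_integral_real mu mOm).
  - by apply: mresidual; exact: measurable_cst.
  - exact: (measurable_funD m2 mn2).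
  - by move=> x; rewrite sqr_ge0.
  - move=> x _; have : (g x ^+ 2 <= 1)%R.
      by rewrite -real_normK ?num_real// expr_le1.
    by rewrite /=; have := sqr_ge0 (g x - n x)%R; nra.
have n20 x : (0 <= 2 * n x ^+ 2)%R by rewrite mulr_ge0 ?sqr_ge0.
rewrite (ge0_integralD_real mu mOm m2 mn2 (fun=> ler0n _ 2) n20).
apply: lte_add_pinfty.
  by rewrite (integral_cst mu mOm 2%:E) muOmega; exact: lte_mul_pinfty.
rewrite (ge0_integralZ_real mu mOm (measurable_funX 2 mn) (fun x => sqr_ge0 (n x)))//.
exact: lte_mul_pinfty.
Qed.

Let Hs_ge0 (v : 'rV[R]_d -> R) : 0 <= Hs_seminorm2 s v.
Proof.
by apply: integral_ge0 => x _; apply: integral_ge0 => y _;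
  rewrite lee_fin mulr_ge0 ?invr_ge0 ?powR_ge0 ?exprn_ge0.
Qed.

Lemma clip_energy_le :
  alpha%:E * Hs_seminorm2 s T <= 2%:E * \int[mu]_(x in Omega) (`|n x| * T x)%:E.
Proof.
pose I := \int[lam]_x (T x)%:E; pose N := \int[mu]_(x in Omega) (`|n x| * T x)%:E.
pose C := \int[lam]_h (c h * kernel s h)%:E.
have C0 : 0 <= C.
  apply: integral_ge0 => h _; rewrite lee_fin mulr_ge0 ?kernel_ge0//.
  by rewrite le_min ler0n andbT mulr_ge0// dotv_ge0.
have Cfin : C \is a fin_num.
  by rewrite ge0_fin_numE//; exact: min_kernel_integrable.
have I0 : 0 <= I by apply: integral_ge0 => x _; rewrite lee_fin.
have Ifin : I \is a fin_num by rewrite ge0_fin_numE.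
have N0 : 0 <= N by apply: integral_ge0 => x _; rewrite lee_fin mulr_ge0.
have clipE := @Hs_seminorm2_clip_le R d s a (k + b)%R l u psi a0 l0 mu_ mpsi psi01 psi_diff Tfin.
rewrite -/T -/C -/I in clipE.
have muT : measurable_fun setT (fun x => u x - T x)%R by exact: measurable_funB.
have fin_rhs : 2%:E * C * I < +oo.
  by rewrite -(fineK Cfin) -(fineK Ifin) -!EFinM; exact: ltry.
(* The truncation inequality itself shows that the competitor has finite seminorm. *)
have HuT : Hs_seminorm2 s (fun x => u x - T x)%R < +oo.
  apply: le_lt_trans (lte_add_pinfty Hs_u fin_rhs); apply: le_trans clipE.
  by rewrite leeDl.
have Hmin : J u <= J (fun x => u x - T x)%R.
  apply: min_u; split; [exact: lebesgue_measurable_fun| |exact: HuT].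
  by move=> x nx; rewrite u0// T_out// subr0.
pose E1 := \int[mu]_(x in Omega) ((u x - g x - n x) ^+ 2)%:E.
pose E2 := \int[mu]_(x in Omega) ((u x - T x - g x - n x) ^+ 2)%:E.
have mnT : measurable_fun (Omega : set (lebesgueR R d))
    (fun x : lebesgueR R d => `|n x| * T x : R)%R.
  exact: (measurable_funM (measurableT_comp (@normr_measurable R setT) mn) (mL mT)).
have E12 : E2 + (2 * k)%:E * I <= E1 + 2%:E * N.
  have k2 : (0 <= 2 * k)%R by rewrite mulr_ge0.
  have nT0 x : (0 <= `|n x| * T x)%R by rewrite mulr_ge0.
  have r2 : (0 <= 2 :> R)%R by [].
  have c2 (r : R) : measurable_fun (Omega : set (lebesgueR R d)) (cst r : lebesgueR R d -> R).
    exact: measurable_cst.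
  rewrite /I Tint -(ge0_integralZ_real mu mOm (mL mT) T0 k2).
  rewrite -(ge0_integralZ_real mu mOm mnT nT0 r2).
  have e1 := ge0_integralD_real mu mOm (mresidual muT) (measurable_funM (c2 (2 * k)%R) (mL mT))
    (fun x => sqr_ge0 _) (fun x => mulr_ge0 k2 (T0 x)).
  have e2 := ge0_integralD_real mu mOm (mresidual mu_) (measurable_funM (c2 2%R) mnT)
    (fun x => sqr_ge0 _) (fun x => mulr_ge0 r2 (nT0 x)).
  rewrite [X in X <= _](esym e1) [X in _ <= X](esym e2).
  apply: (ge0_le_integral_real mu mOm).
  - exact: (measurable_funD (mresidual muT) (measurable_funM (c2 (2 * k)%R) (mL mT))).
  - exact: (measurable_funD (mresidual mu_) (measurable_funM (c2 2%R) mnT)).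
  - by move=> x; rewrite addr_ge0 ?sqr_ge0//= mulr_ge0.
  move=> x Ox /=; have gp := g_psi Ox; have nn := ler_norm (n x).
  have [Tx0|] := ltP 0%R (T x); last first.
    move=> Tx0; have -> : T x = 0%R by apply/eqP; rewrite eq_le Tx0 T0.
    by rewrite subr0 !mulr0.
  have zk : (k + b < u x - psi x)%R by rewrite -(clip_gt0 _ _ l0).
  have Tz := clip_le (ltW l0) (ltW zk); rewrite -/(T x) in Tz.
  (* The difference of the two integrands is T times this number, which is nonnegative since u - g
     >= u - psi - b >= T + k. *)
  have w0 : (0 <= 2 * u x - 2 * g x - 2 * n x - T x - 2 * k + 2 * `|n x|)%R by lra.
  have := mulr_ge0 (ltW Tx0) w0; move: (u x) (g x) (n x) (T x) `|n x|%R => *; lra.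
have a0' : 0 <= alpha%:E by rewrite lee_fin ltW.
have E1_0 : 0 <= E1 by apply: integral_ge0 => x _; rewrite lee_fin sqr_ge0.
have E2_0 : 0 <= E2 by apply: integral_ge0 => x _; rewrite lee_fin sqr_ge0.
exact: (energy_balance alpha0 k0 E1_0 E1fin E2_0 N0 I0 Tfin C0 Cfin (Hs_ge0 u) Hs_u
  (Hs_ge0 _) (Hs_ge0 T) E12 Hmin clipE alpha_k).
Qed.

Lemma hoelder_level (q : R) (A : set 'rV[R]_d) : (1 < q)%R -> in_Lp Omega q n ->
  measurable A -> lam A < +oo ->
  \int[mu]_(x in Omega) (`|n x| * \1_A x)%:E <=
  (Lp_norm Omega q n * fine (lam A) `^ (1 - q^-1))%:E.
Proof.
move=> q1 nq mA finA.
have q0 : (0 < q)%R := lt_trans ltr01 q1.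
have e0 : (0 < 1 - q^-1)%R by rewrite subr_gt0 invf_lt1.
have mA' : measurable (A : set (lebesgueR R d)) := lebesgue_measurable mA.
have mz : measurable_fun [set: lebesgueR R d] (zero_ext Omega n : lebesgueR R d -> R).
  by move: nq; rewrite /in_Lp inE => /andP[+ _]; rewrite inE.
have finq : 'N[mu]_(q%:E)[EFin \o zero_ext Omega n] < +oo.
  by move: nq; rewrite /in_Lp inE => /andP[_ +]; rewrite inE.
have m1A : measurable_fun [set: lebesgueR R d] (\1_A : lebesgueR R d -> R).
  exact: measurable_indic.
have conj : (q^-1 + (1 - q^-1)^-1^-1 = 1)%R by rewrite invrK addrC subrK.
have e0' : (0 < (1 - q^-1)^-1)%R by rewrite invr_gt0.
have := hoelder mu mz m1A q0 e0' conj.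
have -> : 'N[mu]_((1 - q^-1)^-1)%:E[EFin \o \1_A] = (fine (lam A) `^ (1 - q^-1))%:E.
  rewrite unlock invrK.
  rewrite (_ : \int[mu]_x _ = (fine (lam A))%:E) ?poweR_EFin//.
  rewrite -[RHS]/((fine (lam A))%:E) fineK ?ge0_fin_numE// -(borel_lebesgueE mA).
  have -> : mu A = \int[mu]_x (\1_A x)%:E.
    by rewrite (integral_indic mu measurableT mA') setIT.
  apply: eq_integral => x _; rewrite /= indicE.
  case: (x \in A); rewrite /= ?normr1 ?normr0 ?powR1//.
  by rewrite powR0// gt_eqF.
rewrite Lnorm1 -[X in _ <= X * _]fineK; last by rewrite ge0_fin_numE// Lnorm_ge0.
rewrite -EFinM; apply: le_trans.
rewrite integral_mkcond le_eqVlt; apply/orP; left; apply/eqP.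
apply: eq_integral => x _; rewrite patchE /zero_ext /patch /=.
case: ifPn => _; last by rewrite mul0r normr0.
by rewrite normrM (ger0_norm (_ : 0 <= \1_A x)%R).
Qed.

(* Stampacchia's level inequality. Using the bounded truncation T <= l rather than
   (u - psi - k - b)_+ makes every q > d/(2s) admissible, also below 2. *)
Lemma level_step (q r : R) : (1 < q)%R -> in_Lp Omega q n -> (0 < r)%R ->
  lam [set x | k + b < u x - psi x]%R <= ((2 * r) ^+ d / 2)%:E ->
  (alpha * l * ball_mass d s r)%:E * lam [set x | k + b + l < u x - psi x]%R <=
  (2 * Lp_norm Omega q n * ((2 * r) ^+ d / 2) `^ (1 - q^-1))%:E.
Proof.
move=> q1 nq r0.
set L := [set x | _]%R; set L' := [set x | _]%R => Lr.
have mL_ : measurable L by exact: mlevel.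
have mL' : measurable L' by exact: mlevel.
have L'L : L' `<=` L by move=> x; rewrite /L /L' /=; apply: lt_trans; rewrite ltrDl.
have Loo : lam L < +oo by apply: le_lt_trans Lr (ltry _).
have L'oo : lam L' < +oo by apply: le_lt_trans Loo; apply: le_measure; rewrite ?inE.
have TL' x : L' x -> T x = l by move=> Lx; apply: clip_eq; apply: ltW.
have TL x : ~ L x -> T x = 0%R.
  move=> nL; apply/eqP; rewrite eq_le T0 andbT leNgt (clip_gt0 _ _ l0).
  exact/negP.
have lower := Hs_seminorm2_ge s0 mT mL' mL_ L'L TL' TL r0 Lr.
have N_le : \int[mu]_(x in Omega) (`|n x| * T x)%:E <=
    l%:E * \int[mu]_(x in Omega) (`|n x| * \1_L x)%:E.
  have mnabs := measurableT_comp (@normr_measurable R setT) mn.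
  have m1L : measurable_fun (Omega : set (lebesgueR R d)) (\1_L : lebesgueR R d -> R).
    by apply: (mL (f := \1_L)); exact: measurable_indic.
  have p1 x : (0 <= `|n x| * \1_L x)%R by rewrite mulr_ge0.
  have m1 := measurable_funM mnabs m1L.
  rewrite -(ge0_integralZ_real mu mOm m1 p1 (ltW l0)).
  apply: (ge0_le_integral_real mu mOm).
  - exact: (measurable_funM mnabs (mL mT)).
  - apply: (measurable_funM (f := cst l) _ m1); exact: measurable_cst.
  - by move=> x; rewrite mulr_ge0.
  move=> x _; rewrite mulrCA ler_wpM2l// indicE; have [xL|/negP nL] := boolP (x \in L).
    by rewrite mulr1.
  by rewrite mulr0 TL// => Lx; apply: nL; rewrite inE.
have Lp0 : (0 <= Lp_norm Omega q n)%R by rewrite fine_ge0// Lnorm_ge0.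
have q0 : (0 <= 1 - q^-1)%R by rewrite subr_ge0 ltW// invf_lt1// (lt_trans ltr01).
have fL : (fine (lam L) `^ (1 - q^-1) <= ((2 * r) ^+ d / 2) `^ (1 - q^-1))%R.
  apply: ge0_ler_powR => //; rewrite ?nnegrE ?fine_ge0//.
    by rewrite divr_ge0// exprn_ge0// mulr_ge0// ltW.
  by rewrite -lee_fin fineK// ge0_fin_numE.
(* The seminorm contributes l^2 and the noise term only l, so one factor l remains on the left. *)
have total : alpha%:E * ((l ^+ 2 * ball_mass d s r)%:E * lam L') <=
    2%:E * (l%:E * (Lp_norm Omega q n * ((2 * r) ^+ d / 2) `^ (1 - q^-1))%:E).
  have al0 : 0 <= alpha%:E by rewrite lee_fin ltW.
  apply: (le_trans (lee_wpmul2l al0 lower)); apply: (le_trans clip_energy_le).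
  apply: lee_wpmul2l => //; apply: (le_trans N_le).
  apply: lee_wpmul2l; first by rewrite lee_fin ltW.
  apply: (le_trans (hoelder_level q1 nq mL_ Loo)).
  by rewrite lee_fin ler_wpM2l.
have [y yE] : exists y, lam L' = y%:E by exists (fine (lam L')); rewrite fineK// ge0_fin_numE.
rewrite yE -!EFinM !lee_fin in total *; rewrite -(ler_pM2l l0); lra.
Qed.

End level.

(** The thresholds increase from e to 2 e while the volumes of the level sets above them decay
    geometrically. The decay is a hypothesis so that [K] and [t] can be fixed before alpha, n, u and
    the barrier. *)
Lemma barrier_level_null (q e r0 K t : R) : (1 < q)%R -> in_Lp Omega q n ->
  (0 < e)%R -> (0 < r0)%R -> (0 < t < 1)%R -> (0 < d)%N ->
  lam Omega <= ((2 * r0) ^+ d / 2)%:E ->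
  (Lp_norm Omega q n / alpha <= K * e)%R ->
  (alpha * fine (\int[lam]_h (c h * kernel s h)%:E)%E <= e)%R ->
  (forall (N beta e y : R) (j : nat), 0 < beta -> 0 < e -> N / beta <= K * e ->
    beta * (e / 2 ^+ j.+1) * ball_mass d s (r0 * t ^+ j) * y <=
      2 * N * ((2 * (r0 * t ^+ j)) ^+ d / 2) `^ (1 - q^-1) ->
    y <= (2 * (r0 * t ^+ j.+1)) ^+ d / 2)%R ->
  lam [set x | 2 * e + b < u x - psi x]%R = 0.
Proof.
move=> q1 nq e0 r00 t01 d0 Or0 nK aC decay.
have [t0 t1] := andP t01.
(* The thresholds start at e and not at 0 because each level step needs a threshold of at least
   alpha C. *)
pose kk j : R := (e + e * (1 - 2 ^- j))%R.
pose L j := [set x | kk j + b < u x - psi x]%R.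
have rt j : (0 < r0 * t ^+ j)%R by rewrite mulr_gt0// exprn_gt0.
have ee j : (0 <= e * (1 - 2 ^- j))%R.
  by rewrite mulr_ge0 ?(ltW e0)// subr_ge0 invf_le1 ?exprn_gt0// exprn_ege1// ler1n.
have L_le j : lam (L j) <= ((2 * (r0 * t ^+ j)) ^+ d / 2)%:E.
  elim: j => [|j IH].
    (* The initial level set lies in [Omega], since outside u = 0 is at most psi + b. *)
    rewrite expr0 mulr1; apply: le_trans Or0.
    apply: le_measure; rewrite ?inE; [exact: mlevel|exact: mOmega|].
    move=> x; rewrite /L /kk /= expr0 invr1 subrr mulr0 addr0 => Lx.
    apply: contrapT => nx; move: Lx; rewrite u0// sub0r.
    by apply/negP; rewrite -leNgt; have := psi_out nx; lra.
  have l0 : (0 < e / 2 ^+ j.+1)%R by rewrite divr_gt0// exprn_gt0.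
  have kj0 : (0 <= kk j)%R by rewrite addr_ge0// ltW.
  have aCk : (alpha * fine (\int[lam]_h (c h * kernel s h)%:E)%E <= kk j)%R.
    by apply: (le_trans aC); rewrite lerDl.
  have step := level_step l0 kj0 aCk q1 nq (rt j) IH.
  have LS : L j.+1 = [set x | kk j + b + e / 2 ^+ j.+1 < u x - psi x]%R.
    have kE : (kk j.+1 + b = kk j + b + e / 2 ^+ j.+1)%R.
      by rewrite /kk exprS; field; rewrite expf_neq0.
    by rewrite /L kE.
  rewrite -LS in step; have Lfin : lam (L j.+1) \is a fin_num.
    rewrite ge0_fin_numE//; apply: (@le_lt_trans _ _ (lam (L j))).
      apply: le_measure; rewrite ?inE; [exact: mlevel|exact: mlevel|].
      by rewrite LS => x; rewrite /L /=; apply: lt_trans; rewrite ltrDl.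
    by apply: (le_lt_trans IH); exact: ltry.
  move: step; rewrite -(fineK Lfin) -EFinM !lee_fin; exact: decay.
have sub j : [set x | 2 * e + b < u x - psi x]%R `<=` L j.
  move=> x; rewrite /L /=; apply: le_lt_trans; rewrite lerD2r /kk.
  have : (0 <= e * 2 ^- j)%R by rewrite mulr_ge0 ?invr_ge0 ?exprn_ge0// ltW.
  by move: (2 ^- j) => z; lra.
have le_j j : lam [set x | 2 * e + b < u x - psi x]%R <= ((2 * (r0 * t ^+ j)) ^+ d / 2)%:E.
  apply: le_trans (L_le j); apply: le_measure; rewrite ?inE; [exact: mlevel|exact: mlevel|].
  exact: sub.
have fin0 : lam [set x | 2 * e + b < u x - psi x]%R \is a fin_num.
  by rewrite ge0_fin_numE//; apply: le_lt_trans (le_j 0%N) (ltry _).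
apply/eqP; rewrite eq_le measure_ge0 andbT.
move: fin0 le_j => /fineK <-; move: (fine _) => y le_j; rewrite lee_fin.
apply: (@geometric_le0 _ y ((2 * r0) ^+ d / 2)%R (t ^+ d)%R).
  by rewrite exprn_gt0//= exprn_ilt1 ?ltW// -lt0n.
move=> j; rewrite -lee_fin; apply: (le_trans (le_j j)).
rewrite lee_fin mulrA exprMn -exprM mulnC exprM.
by rewrite mulrAC.
Qed.

End barrier_comparison.

(** * Uniform bounds for minimizers *)

Section barrier.
Context (R : realType) (d : nat) (x0 : 'rV[R]_d) (r : R).
Hypothesis r0 : 0 < r.
Implicit Types x h : 'rV[R]_d.

(* Semiconcave, vanishing at x0 and equal to 1 at distance r from x0: translates
   of a single function, so that all constants depend on r only. *)
Definition barrier x : R := Num.min (dotv (x - x0) (x - x0) / r ^+ 2) 1.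

Let r2 : 0 < r ^+ 2. Proof. by rewrite exprn_gt0. Qed.

Lemma barrier_itv x : 0 <= barrier x <= 1.
Proof. by rewrite le_min ler01 andbT divr_ge0 ?dotv_ge0 ?(ltW r2)//= ge_min lexx orbT. Qed.

Lemma barrier_far x : r <= `|x - x0| -> barrier x = 1.
Proof.
move=> rx; rewrite /barrier min_r// ler_pdivlMr// mul1r -sqr_enorm.
rewrite lerXn2r ?nnegrE ?enorm_ge0 ?(ltW r0)//.
exact: le_trans rx (norm_le_enorm _).
Qed.

(** The quadratic has second difference exactly 2 |h|^2 / r^2 and the constant 1 has second
    difference 0; a minimum inherits an upper bound valid for both. The alternative bound 2 comes
    from the values lying in [0, 1]. *)
Lemma barrier_diff x h :
  barrier (x + h) + barrier (x - h) <= 2 * barrier x + Num.min (2 / r ^+ 2 * dotv h h) 2.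
Proof.
have bl y : barrier y <= dotv (y - x0) (y - x0) / r ^+ 2 by rewrite ge_min lexx.
have b1 y : barrier y <= 1 by have /andP[] := barrier_itv y.
have b0 : 0 <= barrier x by have /andP[] := barrier_itv x.
have i0 : 0 <= 2 / r ^+ 2 * dotv h h by rewrite mulr_ge0 ?dotv_ge0 ?divr_ge0 ?(ltW r2).
have h1 := b1 (x + h); have h2 := b1 (x - h); have h3 := bl (x + h); have h4 := bl (x - h).
have e1 : dotv (x + h - x0) (x + h - x0) =
    dotv (x - x0) (x - x0) + 2 * dotv (x - x0) h + dotv h h.
  rewrite addrAC; move: (x - x0) => y.
  by rewrite dotvDl !dotvDr (dotvC h y); ring.
have e2 : dotv (x - h - x0) (x - h - x0) =
    dotv (x - x0) (x - x0) - 2 * dotv (x - x0) h + dotv h h.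
  rewrite addrAC; move: (x - x0) => y.
  by rewrite dotvDl !dotvDr !dotvNl !dotvNr (dotvC h y); ring.
rewrite e1 in h3; rewrite e2 in h4.
have [mi|mi] := leP (2 / r ^+ 2 * dotv h h) 2; last by lra.
have [xi|xi] := leP 1 (dotv (x - x0) (x - x0) / r ^+ 2).
  have bx : barrier x = 1 by rewrite /barrier min_r.
  by rewrite bx; lra.
have -> : barrier x = dotv (x - x0) (x - x0) / r ^+ 2 by rewrite /barrier min_l// ltW.
apply: le_trans (lerD h3 h4) _; rewrite le_eqVlt; apply/orP; left; apply/eqP; ring.
Qed.

Lemma measurable_barrier : measurable_fun setT barrier.
Proof.
apply: (@measurable_minr _ _ _ _ (fun x => dotv (x - x0) (x - x0) / r ^+ 2) (cst 1)) => //.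
apply: measurable_funM => //.
apply: (eq_measurable_fun (fun x : 'rV[R]_d => enorm (x - x0) ^+ 2)).
  by move=> x _; rewrite sqr_enorm.
apply: measurable_funX.
have ms : measurable_fun setT (fun x : 'rV[R]_d => x - x0) by exact: measurable_addv.
exact: (measurableT_comp (@measurable_enorm R d) ms).
Qed.

Lemma barrier_near (e : R) : 0 < e ->
  exists2 t, 0 < t & forall x, `|x - x0| < t -> barrier x < e.
Proof.
move=> e0; pose t := Num.min 1 (e * r ^+ 2 / (d%:R + 1)).
have d1 : 0 < d%:R + 1 :> R by rewrite ltr_wpDl.
have t0 : 0 < t by rewrite lt_min ltr01 divr_gt0// mulr_gt0.
exists t => // x xt; rewrite gt_min ltr_pdivrMr// -sqr_enorm; apply/orP; left.
have [x1 x2] : `|x - x0| < 1 /\ `|x - x0| * (d%:R + 1) < e * r ^+ 2.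
  by move: xt; rewrite lt_min ltr_pdivlMr// => /andP[].
apply: le_lt_trans x2; apply: (@le_trans _ _ ((Num.sqrt d%:R * `|x - x0|) ^+ 2)).
  by rewrite lerXn2r ?nnegrE ?enorm_ge0 ?mulr_ge0 ?sqrtr_ge0// enorm_le_norm.
rewrite exprMn sqr_sqrtr ?ler0n// mulrC.
apply: ler_pM => //; last by rewrite lerDl.
by rewrite expr2 ler_piMl// ltW.
Qed.

(** Were u x0 > t, then u - psi would exceed t on a whole cube about x0, where psi is close to 0,
    and a cube is not null. *)
Lemma barrier_pointwise_le (u : 'rV[R]_d -> R) (t : R) :
  {for x0, continuous u} ->
  borel_lebesgue R d [set x | t < u x - barrier x] = 0%E -> measurable_fun setT u ->
  u x0 <= t.
Proof.
move=> cu null mu_; rewrite leNgt; apply/negP => tu.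
have e0 : 0 < (u x0 - t) / 2 by rewrite divr_gt0 ?subr_gt0.
have [t1 t10 bt] := barrier_near e0.
have /cvgrPdist_lt/(_ _ e0)/nbhs_ballP[t2 /= t20 ut] := cu.
pose m := Num.min t1 t2; have m0 : 0 < m by rewrite lt_min t10.
have sub : ball x0 m `<=` [set x | t < u x - barrier x].
  move=> x; rewrite ballvE /= /m lt_min => /andP[xt1 xt2].
  have := ut x; rewrite ballvE /= => /(_ xt2); rewrite ltr_norml => /andP[_ ux].
  by have := bt x; rewrite distrC => /(_ xt1) bx; lra.
have mset : measurable [set x | t < u x - barrier x].
  have mub : measurable_fun setT (fun x => u x - barrier x).
    by apply: measurable_funB => //; exact: measurable_barrier.
  rewrite -[X in measurable X]setTI.
  have := mub measurableT `]t, +oo[%classic (measurable_itv _).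
  by congr measurable; apply/seteqP; split => x /= [_]; rewrite in_itv/= andbT.
have : (borel_lebesgue R d (ball x0 m) <= 0)%E.
  by rewrite -null; apply: le_measure; rewrite ?inE//; exact: measurable_ballv.
by rewrite borel_lebesgue_ball// lee_fin leNgt exprn_gt0// mulr_gt0.
Qed.

End barrier.

Section uniform_bounds.
Context (R : realType) (d : nat).
Local Notation lam := (borel_lebesgue R d).
Local Notation mu := (lebesgue R d).

Lemma Hs_seminorm2N (s : R) (v : 'rV[R]_d -> R) :
  Hs_seminorm2 s (fun x => - v x) = Hs_seminorm2 s v.
Proof.
apply: eq_integral => x _; apply: eq_integral => y _.
by rewrite -opprD normrN.
Qed.

Lemma Hs0N (s : R) (Omega : set 'rV[R]_d) v : Hs0 s Omega v -> Hs0 s Omega (fun x => - v x).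
Proof.
move=> [mv v0 Hv]; split; last by rewrite Hs_seminorm2N.
  exact: measurableT_comp.
by move=> x /v0 ->; rewrite oppr0.
Qed.

Let zero_extN (Omega : set 'rV[R]_d) n :
  zero_ext Omega (fun x => - n x) = (fun x => - zero_ext Omega n x).
Proof. by apply/funext => x; rewrite /zero_ext /patch; case: ifPn => //; rewrite oppr0. Qed.

Let LnormN (q : R) (f : 'rV[R]_d -> R) :
  ('N[mu]_(q%:E)[EFin \o (fun x => - f x)%R] = 'N[mu]_(q%:E)[EFin \o f])%E.
Proof.
rewrite -[LHS]Lnorm_abse -[RHS]Lnorm_abse; apply: eq_Lnorm => x /=.
by rewrite normrN.
Qed.

Lemma Lp_normN (Omega : set 'rV[R]_d) (q : R) n :
  Lp_norm Omega q (fun x => - n x) = Lp_norm Omega q n.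
Proof. by rewrite /Lp_norm zero_extN LnormN. Qed.

Lemma in_LpN (Omega : set 'rV[R]_d) (q : R) n :
  in_Lp Omega q n -> in_Lp Omega q (fun x => - n x).
Proof.
rewrite /in_Lp !inE => /andP[+ +]; rewrite !inE /= => mn nfin.
rewrite zero_extN; apply/andP; split; rewrite inE/=; first exact: measurableT_comp.
by rewrite /finite_norm LnormN.
Qed.

(** Supplies the initial radius of the iteration. Doubling the side of an enclosing cube multiplies
    its volume by 2^d, which is at least 2 for d > 0. *)
Lemma bounded_volume (A : set 'rV[R]_d) : (0 < d)%N -> bounded_set A -> measurable A ->
  exists2 r0 : R, 0 < r0 & (lam A <= ((2 * r0) ^+ d / 2)%:E)%E.
Proof.
move=> d0 [M [_ AM]] mA; pose m := Num.max M 0 + 1.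
have m0 : 0 < m by rewrite ltr_wpDl// le_max lexx orbT.
have Am : A `<=` ball 0 (m + 1).
  move=> x Ax; rewrite ballvE /= sub0r normrN (@le_lt_trans _ _ m)// ?ltrDl//.
  by apply: AM => //; rewrite /m ltr_pwDr// le_max lexx.
have m1 : 0 < m + 1 by rewrite addr_gt0.
exists (2 * (m + 1)); first by rewrite mulr_gt0.
apply: (@le_trans _ _ (lam (ball 0 (m + 1)))).
  by apply: le_measure; rewrite ?inE//; exact: measurable_ballv.
rewrite borel_lebesgue_ball// lee_fin; set X := 2 * (m + 1).
have X0 : 0 <= X by rewrite mulr_ge0// ltW.
rewrite [(2 * X) ^+ d]exprMn mulrAC; apply: ler_peMl; first exact: exprn_ge0.
by rewrite -(prednK d0) exprS mulrAC mulfV// mul1r exprn_ege1// ler1n.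
Qed.

(** [K] and [C] are chosen before alpha, n, u and x0. This is the uniformity that lets a single tail
    of the sequence serve all points. *)
Lemma minimizer_bounds (s q r e : R) (Omega D : set 'rV[R]_d) :
  0 < s < 1 -> 2 * s < d%:R -> d%:R / (2 * s) < q ->
  open Omega -> bounded_set Omega -> open D -> D `<=` Omega -> 0 < r -> 0 < e ->
  exists K C : R, [/\ 0 < K, 0 <= C & forall (alpha : R) (n u : 'rV[R]_d -> R),
    0 < alpha -> in_Lp Omega 2 n -> in_Lp Omega q n ->
    Lp_norm Omega q n / alpha <= K -> alpha * C <= e ->
    minimizer s Omega D alpha n u -> (forall x, Omega x -> {for x, continuous u}) ->
    forall x0, Omega x0 ->
      ((forall y, `|y - x0| < r -> ~ D y) -> u x0 <= 2 * e) /\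
      ((forall y, `|y - x0| < r -> D y) -> 1 - 2 * e <= u x0)].
Proof.
move=> /andP[s0 s1] sd dq oO bO oD DO r0 e0.
have dpos : (0 < d)%N by rewrite -(@ltr0n R) (lt_trans _ sd)// mulr_gt0.
have q1 : 1 < q by apply: lt_trans dq; rewrite ltr_pdivlMr ?mul1r// mulr_gt0.
have mO := open_measurable_rv oO; have mD := open_measurable_rv oD.
have [r1 r10 Or1] := bounded_volume dpos bO mO.
have [K [t [K0 t01 decay]]] := geometric_level_decay dpos s0 dq r10.
pose a := 2 / r ^+ 2; have a0 : 0 <= a by rewrite divr_ge0// exprn_ge0// ltW.
pose C := fine (\int[lam]_h (Num.min (a * dotv h h) 2 * kernel s h)%:E)%E.
have C0 : 0 <= C.
  apply: fine_ge0; apply: integral_ge0 => h _; rewrite lee_fin mulr_ge0 ?kernel_ge0//.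
  by rewrite le_min ler0n andbT mulr_ge0// dotv_ge0.
exists (K * e), C; split => //; first exact: mulr_gt0.
move=> alpha n u alpha0 n2 nq nK aC [Hu min_u] cu x0 Ox0.
have [_ u_out Hsu] := Hu.
have mu_ : measurable_fun setT u := measurable_continuous_ext oO cu u_out.
have mb : measurable_fun setT (barrier x0 r) := measurable_barrier x0 r.
have finO : (lam Omega < +oo)%E by apply: le_lt_trans Or1 (ltry _).
have m1D : measurable_fun setT (\1_D : 'rV[R]_d -> R) by exact: measurable_indic.
have far x : ~ `|x - x0| < r -> barrier x0 r x = 1.
  by move=> /negP; rewrite -leNgt; exact: barrier_far.
split=> H.
  have g1 x : `|\1_D x : R| <= 1 by rewrite indicE; case: (_ \in _); rewrite ?normr1// normr0.
  have g_psi x : Omega x -> (\1_D x : R) <= barrier x0 r x + 0.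
    move=> _; rewrite addr0 indicE; have [/set_mem Dx|_] := boolP (x \in D).
      by rewrite far// => /H.
    by have /andP[] := barrier_itv x0 r0 x.
  have psi_out x : ~ Omega x -> 0 <= barrier x0 r x + 0.
    by move=> _; rewrite addr0; have /andP[] := barrier_itv x0 r0 x.
  have null := barrier_level_null s0 s1 a0 alpha0 mO finO mu_ u_out Hsu mb
    (barrier_itv x0 r0) (barrier_diff x0 r0) m1D g1 n2 g_psi psi_out min_u q1 nq e0 r10
    t01 dpos Or1 nK aC decay.
  rewrite addr0 in null.
  exact: (barrier_pointwise_le r0 (cu _ Ox0) null mu_).
have g1 x : `|- \1_D x : R| <= 1.
  by rewrite normrN indicE; case: (_ \in _); rewrite ?normr1// normr0.
have g_psi x : Omega x -> (- \1_D x : R) <= barrier x0 r x + (-1).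
  move=> _; have /andP[b0 _] := barrier_itv x0 r0 x.
  rewrite indicE; have [_|/negP nD] := boolP (x \in D); first by rewrite /=; lra.
  by rewrite far ?subrr ?oppr0// => /H Dx; apply: nD; rewrite inE.
(* Here the barrier must equal 1 outside [Omega]; it does, because the ball about x0 lies in [D],
   hence in [Omega]. *)
have psi_out x : ~ Omega x -> 0 <= barrier x0 r x + (-1).
  by move=> nO; rewrite far ?subrr// => /H /DO.
have mu_N : measurable_fun setT (fun x => - u x) by exact: measurableT_comp.
have u_outN x : ~ Omega x -> - u x = 0 by move=> /u_out ->; rewrite oppr0.
have HsuN : (Hs_seminorm2 s (fun x => - u x)%R < +oo)%E by rewrite Hs_seminorm2N.
have m1DN : measurable_fun setT (fun x => - \1_D x : R) by exact: measurableT_comp.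
(* The functional with data -1_D and -n is the original one composed with v |-> -v, so -u minimizes
   it. *)
pose JN (v : 'rV[R]_d -> R) := (\int[mu]_(x in Omega) ((v x - (- \1_D x) - (- n x)) ^+ 2)%:E
   + alpha%:E * Hs_seminorm2 s v)%E.
have JNE v : JN v = energy s Omega D alpha n (fun x => - v x).
  rewrite /JN /energy Hs_seminorm2N; congr (_ + _)%E; apply: eq_integral => x _.
  by congr EFin; ring.
have min_uN v : Hs0 s Omega v -> (JN (fun x => - u x)%R <= JN v)%E.
  move=> Hv; rewrite !JNE (_ : (fun x => - - u x) = u); last first.
    by apply/funext => x; rewrite opprK.
  by apply: min_u; exact: Hs0N.
have nKN : Lp_norm Omega q (fun x => - n x) / alpha <= K * e by rewrite Lp_normN.
have null := barrier_level_null s0 s1 a0 alpha0 mO finO mu_N u_outN HsuN mb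
  (barrier_itv x0 r0) (barrier_diff x0 r0) m1DN g1 (in_LpN n2) g_psi psi_out min_uN q1
  (in_LpN nq) e0 r10 t01 dpos Or1 nKN aC decay.
have cuN : {for x0, continuous (fun x => - u x)} by apply: continuousN; exact: cu.
have := barrier_pointwise_le r0 cuN null mu_N; lra.
Qed.

End uniform_bounds.

(** * Boundaries of level sets *)

Section boundary_points.
Context (R : realType) (d : nat).
Implicit Types (x y p : 'rV[R]_d) (A D : set 'rV[R]_d).

Lemma closed_bdry A : closed (bdry A).
Proof.
by apply: closedI; [exact: closed_closure|apply: open_closedC; exact: open_interior].
Qed.

Lemma bounded_bdry A : bounded_set A -> bounded_set (bdry A).
Proof.
move=> [M [Mr AM]]; exists (M + 1); split; first by rewrite realD.
move=> N MN x /bdryP/(_ _ ltr01)[y [_ [Ay _ xy _]]].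
have yM : `|y| <= N - 1 by apply: AM => //; rewrite ltrBrDr.
have h := ler_normD (x - y) y; rewrite subrK in h; apply: (le_trans h).
by have := lerD (ltW xy) yM; rewrite [1 + _]addrC subrK.
Qed.

Lemma inner_point A x (e : R) : open A -> bdry A x -> 0 < e ->
  exists p r, [/\ 0 < r, `|x - p| < e & forall y, `|y - p| < r -> A y].
Proof.
move=> oA /bdryP Ax e0; have [p [_ [Ap _ xp _]]] := Ax e e0.
have /nbhs_ballP[r /= r0 rA] : nbhs p A by apply: open_nbhs_nbhs; split.
exists p, r; split => // y yp; apply: rA; by rewrite ballvE/= distrC.
Qed.

(* Move against e: below the graph of g the hyperplane coordinate is unchanged
   and the height decreases. *)
Lemma outer_point A x (e : R) : open A -> lipschitz_boundary A -> bdry A x -> 0 < e ->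
  exists p r, [/\ 0 < r, `|x - p| < e & forall y, `|y - p| < r -> ~ A y].
Proof.
move=> oA lA Ax e0; have [r [v [g [L [r0 v1 gL chart]]]]] := lA _ Ax.
have vv : dotv v v = 1 by rewrite -sqr_enorm v1 expr1n.
pose proj y := y - dotv y v *: v.
have gx : dotv x v <= g (proj x).
  rewrite leNgt; apply/negP => xA; case: Ax => _; apply; apply: open_nbhs_nbhs; split => //.
  apply/chart => //; by rewrite subrr /enorm -(scale0r (0 : 'rV[R]_d)) dotvZl mul0r sqrtr0.
pose sd : R := Num.sqrt d%:R + 1; have sd1 : 0 < sd by rewrite ltr_wpDl// sqrtr_ge0.
have en y : enorm y <= sd * `|y|.
  by apply: le_trans (enorm_le_norm y) _; rewrite ler_wpM2r// lerDl.
have n1 : `|v| <= 1 by rewrite -v1; exact: norm_le_enorm.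
(* The second bound keeps p, and later a neighbourhood of it, inside the chart of Euclidean radius
   r. *)
pose t := Num.min (e / 2) (r / (2 * sd)).
have t0 : 0 < t by rewrite lt_min !divr_gt0// mulr_gt0.
pose p := x - t *: v.
have xp : `|x - p| <= t.
  by rewrite /p opprB addrC subrK normrZ (gtr0_norm t0) ler_piMr// ltW.
have dotp : dotv p v = dotv x v - t by rewrite /p dotvDl dotvNl dotvZl vv mulr1.
have projp : proj p = proj x.
  by rewrite /proj dotp /p; apply/rowP => i; rewrite !mxE; ring.
have dotw w : `|dotv w v| <= d%:R * `|w|.
  apply: le_trans (ler_norm_sum _ _ _) _.
  rewrite mulr_natl -[X in _ *+ X]card_ord -sumr_const; apply: ler_sum => i _.
  rewrite normrM -[leRHS]mulr1; apply: ler_pM => //; first exact: norm_coord_le.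
  exact: le_trans (norm_coord_le _ _) n1.
(* Per unit of sup-norm displacement from p, g of the projection changes by at most k and the height
   by at most d. With [rho] below, the two changes together do not make up for the descent t. *)
pose k : R := `|L| * (sd * (1 + d%:R)); have k0 : 0 <= k by rewrite !mulr_ge0 ?(ltW sd1)// addr_ge0.
pose rho := Num.min (r / (2 * sd)) (t / (k + d%:R + 1)).
have kd0 : 0 < k + d%:R + 1 by rewrite ltr_wpDl// addr_ge0.
have rho0 : 0 < rho by rewrite lt_min !divr_gt0// mulr_gt0.
exists p, rho; split => //.
  by apply: le_lt_trans xp _; rewrite gt_min ltr_pdivrMr// ltr_pMr// ltr1n.
move=> y yp Ay.
have [yp1 yp2] : `|y - p| < r / (2 * sd) /\ `|y - p| * (k + d%:R + 1) < t.
  by move: yp; rewrite lt_min -ltr_pdivlMr// => /andP[].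
have tr : t <= r / (2 * sd) by rewrite ge_min lexx orbT.
have yx : enorm (y - x) < r.
  apply: le_lt_trans (en _) _; rewrite mulrC -ltr_pdivlMr//.
  have -> : r / sd = r / (2 * sd) + r / (2 * sd) by field; rewrite gt_eqF.
  have -> : y - x = (y - p) + (p - x) by rewrite addrA subrK.
  apply: le_lt_trans (ler_normD _ _) _; apply: ltr_leD => //.
  by rewrite distrC; exact: le_trans xp tr.
have /(chart _ yx) gy := Ay; rewrite -/(proj y) in gy.
pose w := y - p; have yE : y = p + w by rewrite /w addrC subrK.
have projw : proj y - proj p = w - dotv w v *: v.
  by rewrite /proj yE dotvDl scalerDl; apply/rowP => i; rewrite !mxE; ring.
have gpy : `|g (proj y) - g (proj p)| <= k * `|w|.
  apply: le_trans (gL _ _) _; apply: (@le_trans _ _ (`|L| * enorm (proj y - proj p))).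
    by rewrite ler_wpM2r ?enorm_ge0// ler_norm.
  rewrite /k -mulrA ler_wpM2l// projw; apply: le_trans (en _) _.
  rewrite -mulrA ler_wpM2l ?(ltW sd1)//; apply: le_trans (ler_normB _ _) _.
  rewrite mulrDl mul1r lerD2l normrZ; apply: le_trans (dotw w).
  by rewrite ler_piMr.
have dyw : dotv y v = dotv x v - t + dotv w v by rewrite yE dotvDl dotp.
have := ler_norm (dotv w v); have := dotw w.
have := gpy; rewrite ler_norml => /andP[gpy1 _].
rewrite projp in gpy1; rewrite dyw in gy; rewrite -/w in yp2.
have e1 : `|w| * (k + d%:R + 1) = k * `|w| + d%:R * `|w| + `|w| by ring.
rewrite e1 in yp2; have := normr_ge0 w.
move: (dotv w v) `|dotv w v| `|w| (k * `|w|) (d%:R * `|w|) gy gpy1 yp2 gx => *.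
lra.
Qed.

End boundary_points.

Section level_set_boundaries.
Context (R : realType) (d : nat).
Implicit Types (x y p q : 'rV[R]_d) (D E : set 'rV[R]_d).

(** The inner and outer balls found at one boundary point serve all nearby ones, so compactness of
    the boundary yields a common radius. It lets one barrier radius act along all of the boundary of
    [D]. *)
Lemma uniform_two_sided D (e : R) : open D -> bounded_set D -> lipschitz_boundary D -> 0 < e ->
  exists2 r, 0 < r & forall x, bdry D x -> exists p q,
    [/\ `|x - p| < e, `|x - q| < e,
        forall y, `|y - p| < r -> D y & forall y, `|y - q| < r -> ~ D y].
Proof.
move=> oD bD lD e0; have e20 : 0 < e / 2 by rewrite divr_gt0.
have /compact_near_coveringP cov : compact (bdry D).
  by apply: bounded_closed_compact; [exact: bounded_bdry|exact: closed_bdry].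
pose P (r : R) x := exists p q,
    [/\ `|x - p| < e, `|x - q| < e,
        forall y, `|y - p| < r -> D y & forall y, `|y - q| < r -> ~ D y].
have nP : \forall r \near (0 : R)^'+, bdry D `<=` P r.
  apply: cov => x Dx.
  have [p [r1 [r10 xp pD]]] := inner_point oD Dx e20.
  have [q [r2 [r20 xq qD]]] := outer_point oD lD Dx e20.
  exists (ball x (e / 2), [set r | r < Num.min r1 r2]).
    split => /=; first exact: nbhsx_ballx.
    by apply: nbhs_right_lt; rewrite lt_min r10.
  move=> [x' r] /= []; rewrite ballvE /= lt_min => xx' /andP[rr1 rr2].
  exists p, q; split.
  - have -> : x' - p = (x' - x) + (x - p) by rewrite addrA subrK.
    by rewrite (le_lt_trans (ler_normD _ _))// (splitr e) ltrD// distrC.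
  - have -> : x' - q = (x' - x) + (x - q) by rewrite addrA subrK.
    by rewrite (le_lt_trans (ler_normD _ _))// (splitr e) ltrD// distrC.
  - by move=> y yp; apply: pD; exact: lt_trans yp rr1.
  - by move=> y yq; apply: qD; exact: lt_trans yq rr2.
have [r [r0 rP]] := filter_ex (filterI (nbhs_right_gt (0 : R)) nP).
by exists r.
Qed.

Lemma dist_set_le x E y (e : R) : E y -> enorm (x - y) <= e -> (dist_set x E <= e%:E)%E.
Proof.
move=> Ey xy; apply: (@le_trans _ _ (enorm (x - y))%:E); last by rewrite lee_fin.
by apply: ereal_inf_lbound; exists y.
Qed.

Lemma hausdorff_dist_le E D (e : R) : 0 <= e ->
  (forall x, E x -> exists2 y, D y & enorm (x - y) <= e) ->
  (forall y, D y -> exists2 x, E x & enorm (y - x) <= e) ->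
  (hausdorff_dist E D <= e%:E)%E.
Proof.
move=> e0 ED DE; rewrite /hausdorff_dist !ge_max lee_fin e0/=; apply/andP; split.
  by apply: ge_ereal_sup => _ [x /ED[y Dy xy] <-]; exact: dist_set_le xy.
by apply: ge_ereal_sup => _ [y /DE[x Ex yx] <-]; exact: dist_set_le yx.
Qed.

Lemma hausdorff_dist_ge0 E D : (0 <= hausdorff_dist E D)%E.
Proof. by rewrite /hausdorff_dist le_max lexx. Qed.

(** Close to x lie a point of [E], whose r-ball must meet [D], and a point outside [E], whose r-ball
    must meet the complement of [D]. The segment between the two points so found crosses the
    boundary of [D]. *)
Lemma bdry_near D E (e r : R) : 0 < r <= e / 2 ->
  (forall x, (forall y, `|y - x| < r -> D y) -> E x) ->
  (forall x, (forall y, `|y - x| < r -> ~ D y) -> ~ E x) ->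
  forall x, bdry E x -> exists2 y, bdry D y & `|x - y| < e.
Proof.
move=> /andP[r0 re] inE_ outE x /bdryP Ex.
have e20 : 0 < e / 2 := lt_le_trans r0 re.
have [y1 [y2 [Ey1 nEy2 xy1 xy2]]] := Ex _ e20.
have near y z : `|x - y| < e / 2 -> `|z - y| < r -> `|x - z| < e.
  move=> xy zy; have -> : x - z = (x - y) + (y - z) by rewrite addrA subrK.
  rewrite (le_lt_trans (ler_normD _ _))// (splitr e) ltrD// distrC.
  exact: lt_le_trans zy re.
have [a Da xa] : exists2 a, D a & `|x - a| < e.
  apply: contrapT => H; apply: (outE y1) => // z zy1 Dz; apply: H; exists z => //.
  exact: near zy1.
have [b nDb xb] : exists2 b, ~ D b & `|x - b| < e.
  apply: contrapT => H; apply: nEy2; apply: inE_ => z zy2; apply: contrapT => nDz.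
  by apply: H; exists z => //; exact: near zy2.
exact: (segment_meets_bdry xa xb Da nDb).
Qed.

End level_set_boundaries.

Lemma cvge0_squeeze (R : realType) (h : nat -> \bar R) :
  (forall k, (0 <= h k)%E) ->
  (forall e : R, 0 < e -> \forall k \near \oo, (h k <= e%:E)%E) -> h @ \oo --> 0%E.
Proof.
move=> h0 hle; apply/fine_cvgP; split.
  have := hle 1 ltr01; apply: filterS => k hk.
  by rewrite ge0_fin_numE// (le_lt_trans hk)// ltry.
apply/cvgr0Pnorm_lt => e e0; have e20 : 0 < e / 2 by rewrite divr_gt0.
have := hle _ e20; apply: filterS => k hk /=.
have hf : h k \is a fin_num by rewrite ge0_fin_numE// (le_lt_trans hk)// ltry.
rewrite ger0_norm ?fine_ge0//; apply: (@le_lt_trans _ _ (e / 2)).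
  by rewrite -lee_fin fineK.
by rewrite ltr_pdivrMr// ltr_pMr// ltr1n.
Qed.

Theorem theorem1 (R : realType) (d : nat) (s q : R) (Omega D : set 'rV[R]_d)
    (alpha : nat -> R) (n u : nat -> 'rV[R]_d -> R) :
  0 < s < 1 -> 2 * s < d%:R ->
  bounded_domain Omega -> lipschitz_boundary Omega -> exterior_ball Omega ->
  D `<=` Omega -> open D -> lipschitz_boundary D ->
  (0 < ereal_inf [set dist_set x (bdry Omega) | x in bdry D])%E ->
  d%:R / (2 * s) < q ->
  (forall k, 0 < alpha k) ->
  (forall k, in_Lp Omega 2 (n k) /\ in_Lp Omega q (n k)) ->
  alpha k @[k --> \oo] --> (0 : R) ->
  Lp_norm Omega 2 (n k) @[k --> \oo] --> (0 : R) ->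
  Lp_norm Omega q (n k) / alpha k @[k --> \oo] --> (0 : R) ->
  (forall k, minimizer s Omega D (alpha k) (n k) (u k)) ->
  (forall k x, Omega x -> {for x, continuous (u k)}) ->
  {ae @lebesgue_measure R, forall theta : R, 0 < theta < 1 ->
    hausdorff_dist (bdry [set x | theta < u k x]) (bdry D) @[k --> \oo] --> 0%E}.
Proof.
move=> s01 sd [oO _ _ bO] _ _ DO oD lD _ dq alpha0 nL alpha_cv _ n_cv min_u cu.
apply: aeW => theta /andP[th0 th1].
apply: cvge0_squeeze => [k|eta eta0]; first exact: hausdorff_dist_ge0.
have bD : bounded_set D.
  by move: bO => [M [Mr OM]]; exists M; split => // N MN x /DO; exact: OM.
pose sd1 : R := Num.sqrt d%:R + 1.
have sd10 : 0 < sd1 by rewrite ltr_wpDl// sqrtr_ge0.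
(* The sup-norm tolerance that guarantees Euclidean distance at most eta. *)
pose e1 := eta / sd1; have e10 : 0 < e1 by rewrite divr_gt0.
have en (x y : 'rV[R]_d) : `|x - y| < e1 -> enorm (x - y) <= eta.
  move=> xy; apply: le_trans (enorm_le_norm _) _.
  apply: (@le_trans _ _ (sd1 * `|x - y|)); first by rewrite ler_wpM2r// lerDl.
  by rewrite mulrC -ler_pdivlMr// ltW.
have [r1 r10 two_sided] := uniform_two_sided oD bD lD e10.
(* [r1] lets the two-sided balls contain barrier balls; e1 / 2 is what [bdry_near] requires. *)
pose r := Num.min r1 (e1 / 2).
have r0 : 0 < r by rewrite lt_min r10 divr_gt0.
have rr1 : r <= r1 by rewrite ge_min lexx.
have re1 : r <= e1 / 2 by rewrite ge_min lexx orbT.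
(* Ensures 2 e < theta < 1 - 2 e, so that the two bounds on u decide on which side of theta it
   lies. *)
pose e := Num.min theta (1 - theta) / 4.
have e0 : 0 < e by rewrite divr_gt0// lt_min th0 subr_gt0.
have eth : 2 * e < theta.
  have : Num.min theta (1 - theta) <= theta by rewrite ge_min lexx.
  by rewrite /e; lra.
have eth1 : theta < 1 - 2 * e.
  have : Num.min theta (1 - theta) <= 1 - theta by rewrite ge_min lexx orbT.
  by rewrite /e; lra.
have [K [C [K0 C0 bounds]]] := minimizer_bounds s01 sd dq oO bO oD DO r0 e0.
(* The added 1 keeps the quotient meaningful when [C] is 0. *)
have eC0 : 0 < e / (C + 1) by rewrite divr_gt0// ltr_wpDl.
move/cvgr0Pnorm_lt : (alpha_cv) => /(_ _ eC0) near_alpha.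
move/cvgr0Pnorm_lt : (n_cv) => /(_ _ K0) near_n.
near=> k.
have ak : `|alpha k| < e / (C + 1) by near: k.
have nk : `|Lp_norm Omega q (n k) / alpha k| < K by near: k.
have [n2 nq] := nL k; have [[_ u_out _] _] := min_u k.
have nk' : Lp_norm Omega q (n k) / alpha k <= K.
  by apply: ltW; apply: le_lt_trans nk; exact: ler_norm.
have ak' : alpha k * C <= e.
  apply: (@le_trans _ _ (alpha k * (C + 1))).
    by rewrite ler_wpM2l ?(ltW (alpha0 k))// lerDl.
  by rewrite -ler_pdivlMr ?ltr_wpDl//; apply: le_trans (ltW ak); rewrite ger0_norm // ltW.
have est := bounds _ _ _ (alpha0 k) n2 nq nk' ak' (min_u k) (cu k).
pose E := [set x | theta < u k x].
have inE_ x : (forall y, `|y - x| < r -> D y) -> E x.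
  move=> H; have Dx : D x by apply: H; rewrite subrr normr0.
  by have [_ /(_ H) h] := est x (DO _ Dx); rewrite /E /=; exact: lt_le_trans eth1 h.
have outE x : (forall y, `|y - x| < r -> ~ D y) -> ~ E x.
  move=> H; rewrite /E /=; apply/negP; rewrite -leNgt; have [Ox|nO] := pselect (Omega x).
    by have [/(_ H) h _] := est x Ox; exact: le_trans h (ltW eth).
  by rewrite u_out// ltW.
apply: hausdorff_dist_le; first exact: ltW.
  move=> x Ex; have [y Dy xy] : exists2 y, bdry D y & `|x - y| < e1.
    by apply: (@bdry_near _ _ D E e1 r) => //; rewrite r0.
  by exists y => //; exact: en.
(* The inner centre belongs to the level set and the outer one does not, so the boundary of the
   level set is met between them, close to y. *)
move=> y /two_sided[p [p' [yp yp' pD p'D]]].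
have Ep : E p by apply: inE_ => z zp; apply: pD; exact: lt_le_trans zp rr1.
have nEp' : ~ E p' by apply: outE => z zp; apply: p'D; exact: lt_le_trans zp rr1.
have [x Ex yx] := segment_meets_bdry yp yp' Ep nEp'.
by exists x => //; exact: en.
Unshelve. all: by end_near.
Qed.
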